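(* Let $\mathbb{F}_s$ be a finite field with $s$ elements, let $m,n\ge 1$ be integers, and let $\psi:\mathbb{N}\to\mathbb{R}_+$ be a non-increasing function. Let $\mathcal{W}(\psi)$ be the set of $m\times n$ matrices $A$ with entries in $\mathbb{F}_s((X^{-1}))$ for which there exist infinitely many $\mathbf{q}\in\mathbb{F}_s[X]^n$ such that $$\|A\mathbf{q}+\mathbf{p}\|^{m}<\psi\bigl(\|\mathbf{q}\|^{n}\bigr)\quad\text{for some }\mathbf{p}\in\mathbb{F}_s[X]^m.$$ Then: (1) almost every $A$ belongs to $\mathcal{W}(\psi)$ if $\int\psi(x)\,dx$ diverges; (2) almost no $A$ belongs to $\mathcal{W}(\psi)$ if $\int\psi(x)\,dx$ converges.
   Context: $\mathbb{F}_s((X^{-1}))$ is the field of Laurent series in $X^{-1}$ over $\mathbb{F}_s$, the completion of $\mathbb{F}_s(X)$ at the infinite place, with its usual ultrametric absolute value, normalized so that $\|f\|=s^{\deg f}$ for nonzero $f\in\mathbb{F}_s[X]$. On $\mathbb{F}_s((X^{-1}))^r$, $\|\cdot\|$ denotes the supremum norm. ''Almost every''/''almost no'' refers to Haar measure on the additive group of $m\times n$ matrices over $\mathbb{F}_s((X^{-1}))$. Since $\psi$ is defined on $\mathbb{N}$ and non-increasing, convergence or divergence of $\int\psi(x)\,dx$ means convergence or divergence of $\sum_{j\ge1}\psi(j)$ (equivalently, of $\int_1^\infty\psi(\lceil x\rceil)\,dx$). The single vector $\mathbf{q}=0$ is irrelevant to the condition ''infinitely many $\mathbf{q}$''. *)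

(* Defs.v *)
From HB Require Import structures.
From mathcomp Require Import all_boot all_order all_algebra.
From mathcomp Require Import all_classical all_reals all_analysis.
From mathcomp Require Import zify.

Set Implicit Arguments.
Unset Strict Implicit.
Unset Printing Implicit Defensive.

Import Order.TTheory GRing.Theory Num.Theory.

Local Open Scope classical_set_scope.
Local Open Scope ring_scope.

(* A Laurent series in X^-1 over K is the family of its coefficients: [f k] is
   the coefficient of X^k, and f k = 0 for all large enough k. *)
Record laurent (K : fieldType) := Laurent {
  lcoef :> int -> K ;
  lcoef_bounded : exists N : int, forall k, N < k -> lcoef k = 0
}.

HB.instance Definition _ (K : fieldType) := gen_eqMixin (laurent K).
HB.instance Definition _ (K : fieldType) := gen_choiceMixin (laurent K).

Section LaurentRing.
Variable K : fieldType.
Implicit Types f g h : laurent K.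

Definition bnd (N : int) (f : int -> K) := forall k, N < k -> f k = 0.

Lemma laurentP f g : (forall k, f k = g k) -> f = g.
Proof.
case: f g => [f hf] [g hg] /= fg.
have {}fg : f = g by apply/funext.
by case: _ / fg hg => hg; rewrite (Prop_irrelevance hf hg).
Qed.

Lemma bnd_ex f : exists N, bnd N f.
Proof. exact: lcoef_bounded. Qed.

Lemma bndW N M (f : int -> K) : N <= M -> bnd N f -> bnd M f.
Proof. by move=> NM fN k Mk; apply: fN; exact: le_lt_trans Mk. Qed.

Lemma bnd_ex2 f g : exists N, bnd N f /\ bnd N g.
Proof.
have [[N fN] [M gM]] := (bnd_ex f, bnd_ex g).
by exists (Num.max N M); split; [apply: bndW fN|apply: bndW gM];
  rewrite le_max lexx ?orbT.
Qed.

Lemma laurent_bndP N f g : bnd N f -> bnd N g ->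
  (forall c : nat, f (N - c%:Z) = g (N - c%:Z)) -> f = g.
Proof.
move=> fN gN fg; apply: laurentP => k.
have [kN|Nk] := leP k N; last by rewrite fN ?gN.
have -> : k = N - `|N - k|%N%:Z by lia.
exact: fg.
Qed.

Fact lzero_subproof : exists N : int, bnd N (fun=> 0).
Proof. by exists 0. Qed.
Definition lzero : laurent K := Laurent lzero_subproof.

Fact lopp_subproof f : exists N, bnd N (fun k => - f k).
Proof. by have [N fN] := bnd_ex f; exists N => k /fN ->; rewrite oppr0. Qed.
Definition lopp f : laurent K := Laurent (lopp_subproof f).

Fact ladd_subproof f g : exists N, bnd N (fun k => f k + g k).
Proof.
have [N [fN gN]] := bnd_ex2 f g.
by exists N => k kN; rewrite fN ?gN ?addr0.
Qed.
Definition ladd f g : laurent K := Laurent (ladd_subproof f g).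

Fact laddA : associative ladd.
Proof. by move=> f g h; apply: laurentP => k /=; rewrite addrA. Qed.
Fact laddC : commutative ladd.
Proof. by move=> f g; apply: laurentP => k /=; rewrite addrC. Qed.
Fact ladd0 : left_id lzero ladd.
Proof. by move=> f; apply: laurentP => k /=; rewrite add0r. Qed.
Fact laddN : left_inverse lzero lopp ladd.
Proof. by move=> f; apply: laurentP => k /=; rewrite addNr. Qed.

HB.instance Definition _ :=
  GRing.isZmodule.Build (laurent K) laddA laddC ladd0 laddN.

Lemma lcoef0 k : (0 : laurent K) k = 0. Proof. by []. Qed.
Lemma lcoefD f g k : (f + g) k = f k + g k. Proof. by []. Qed.
Lemma lcoefN f k : (- f) k = - f k. Proof. by []. Qed.
Lemma lcoefB f g k : (f - g) k = f k - g k. Proof. by []. Qed.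

(* The Cauchy product; the sum has only finitely many nonzero terms. *)
Definition lconv (f g : int -> K) (k : int) : K :=
  \sum_(i \in [set: int]) f i * g (k - i).

Lemma lconv_gt N M f g : bnd N f -> bnd M g -> bnd (N + M) (lconv f g).
Proof.
move=> fN gM k ltk; rewrite /lconv fsbig1 // => i _.
have [iN|Ni] := leP i N; last by rewrite fN ?mul0r.
by rewrite gM ?mulr0 //; lia.
Qed.

Lemma lconv_le N M f g (c : nat) : bnd N f -> bnd M g ->
  lconv f g (N + M - c%:Z) =
  \sum_(i < c.+1) f (N - i%:Z) * g (M - (c - i)%N%:Z).
Proof.
move=> fN gM; rewrite /lconv.
pose D := [set N - (i : nat)%:Z | i in `I_c.+1].
rewrite -(@fsbig_widen _ _ 0 +%R D setT) //; last first.
  move=> i /= [_ Di].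
  have [iN|Ni] := leP i N; last by rewrite fN ?mul0r.
  rewrite gM ?mulr0 //; apply: contrapT => leM; apply: Di.
  by exists `|N - i|%N => /=; lia.
rewrite fsbig_image; last by move=> i j _ _ /=; lia.
rewrite -(fsbig_ord _ c.+1 (fun i => f (N - i%:Z) * g (N + M - c%:Z - (N - i%:Z)))).
by apply: eq_bigr => i _; congr (_ * g _); have := ltn_ord i; lia.
Qed.


(* If f has degree at most N, this is X^-N * f truncated to n terms, as a
   polynomial in the variable X^-1. *)
Definition ltrunc N n (f : int -> K) : {poly K} := \poly_(i < n) f (N - i%:Z).

Lemma coef_lconv N M f g c n : bnd N f -> bnd M g -> (c < n)%N ->
  lconv f g (N + M - c%:Z) = (ltrunc N n f * ltrunc M n g)`_c.
Proof.
move=> fN gM cn; rewrite (lconv_le _ fN gM) coefM.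
apply: eq_bigr => -[i /= ic] _.
by rewrite !coef_poly (leq_ltn_trans _ cn) // (leq_ltn_trans (leq_subr _ _) cn).
Qed.

Lemma coefM_congr (p p' q q' : {poly K}) c :
  (forall j, (j <= c)%N -> p`_j = p'`_j) ->
  (forall j, (j <= c)%N -> q`_j = q'`_j) -> (p * q)`_c = (p' * q')`_c.
Proof.
move=> pp' qq'; rewrite !coefM; apply: eq_bigr => -[i /= ic] _.
by rewrite pp' // qq' // leq_subr.
Qed.

Fact lmul_subproof f g : exists N, bnd N (lconv f g).
Proof.
have [[N fN] [M gM]] := (bnd_ex f, bnd_ex g).
by exists (N + M); exact: lconv_gt.
Qed.
Definition lmul f g : laurent K := Laurent (lmul_subproof f g).

Fact lone_subproof : exists N : int, bnd N (fun k => (k == 0)%:R : K).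
Proof. by exists 0 => k k0; rewrite gt_eqF. Qed.
Definition lone : laurent K := Laurent lone_subproof.

Lemma bnd_lone : bnd 0 lone. Proof. by move=> k k0 /=; rewrite gt_eqF. Qed.

Lemma ltrunc_lone n : ltrunc 0 n.+1 lone = 1.
Proof.
apply/polyP => i; rewrite coef_poly coef1 /= sub0r oppr_eq0.
by case: i => [|i] //=; case: ifP.
Qed.

Fact lmulC : commutative lmul.
Proof.
move=> f g; have [[N fN] [M gM]] := (bnd_ex f, bnd_ex g).
apply: (@laurent_bndP (N + M)) => [||c] /=.
- exact: lconv_gt.
- by rewrite addrC; exact: lconv_gt.
- by rewrite (coef_lconv fN gM (ltnSn c)) (addrC N M) (coef_lconv gM fN (ltnSn c)) mulrC.
Qed.

Fact lmulA : associative lmul.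
Proof.
move=> f g h; have [N fN] := bnd_ex f.
have [[M gM] [L hL]] := (bnd_ex g, bnd_ex h).
have fgb := lconv_gt fN gM; have ghb := lconv_gt gM hL.
apply: (@laurent_bndP (N + (M + L))) => [||c].
- exact: (@lconv_gt _ _ f (lmul g h)).
- by rewrite addrA; exact: (@lconv_gt _ _ (lmul f g) h).
rewrite [LHS](@coef_lconv _ _ f (lmul g h) c c.+1) //.
rewrite addrA [RHS](@coef_lconv _ _ (lmul f g) h c c.+1) //.
transitivity ((ltrunc N c.+1 f * (ltrunc M c.+1 g * ltrunc L c.+1 h))`_c).
  apply: coefM_congr => // j jc.
  by rewrite coef_poly ltnS jc [LHS](coef_lconv (n := c.+1) gM hL).
rewrite mulrA; apply: coefM_congr => // j jc.
by rewrite coef_poly ltnS jc [RHS](coef_lconv (n := c.+1) fN gM).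
Qed.

Fact lmul1 : left_id lone lmul.
Proof.
move=> f; have [N fN] := bnd_ex f.
apply: (@laurent_bndP N) => // [|c].
  by rewrite -[N]add0r; apply: lconv_gt => //; exact: bnd_lone.
rewrite -[N in LHS]add0r [LHS](coef_lconv bnd_lone fN (ltnSn c)).
by rewrite ltrunc_lone mul1r coef_poly ltnSn.
Qed.

Fact lmulDl : left_distributive lmul +%R.
Proof.
move=> f g h; have [N [fN gN]] := bnd_ex2 f g; have [M hM] := bnd_ex h.
have fgN : bnd N (f + g) by move=> k kN; rewrite lcoefD fN ?gN ?addr0.
have fhb := lconv_gt fN hM; have ghb := lconv_gt gN hM.
apply: (@laurent_bndP (N + M)) => [||c].
- exact: (@lconv_gt _ _ (f + g) h).
- by move=> k kN; rewrite lcoefD /= fhb // ghb // addr0.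
rewrite lcoefD [LHS](coef_lconv fgN hM (ltnSn c)).
rewrite [lmul f h _](coef_lconv fN hM (ltnSn c)).
rewrite [lmul g h _](coef_lconv gN hM (ltnSn c)) -coefD -mulrDl.
congr (polyseq (_ * _))`_c; apply/polyP => i.
by rewrite coefD !coef_poly; case: ifP; rewrite ?addr0.
Qed.

Fact lone_neq0 : lone != 0.
Proof.
by apply/eqP => /(congr1 (fun f : laurent K => f 0)) /eqP; rewrite oner_eq0.
Qed.

HB.instance Definition _ := GRing.Zmodule_isComNzRing.Build (laurent K)
  lmulA lmulC lmul1 lmulDl lone_neq0.

Lemma lcoef1 k : (1 : laurent K) k = (k == 0)%:R. Proof. by []. Qed.
Lemma lcoefM f g k : (f * g) k = lconv f g k. Proof. by []. Qed.

Definition isdeg f (d : int) := f d != 0 /\ bnd d f.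

(* The degree of f, i.e. the largest exponent with a nonzero coefficient; it is
   only meaningful for nonzero f. *)
Definition ldeg f : int := xget 0 [set d | isdeg f d].

Lemma isdeg_uniq f d d' : isdeg f d -> isdeg f d' -> d = d'.
Proof.
move=> [fd bd] [fd' bd']; apply/eqP; rewrite eq_le !leNgt.
by apply/andP; split; apply/negP => dd'; [move: fd; rewrite bd'|
  move: fd'; rewrite bd]; rewrite ?eqxx.
Qed.

Lemma ldegP f : f != 0 -> isdeg f (ldeg f).
Proof.
move=> f0; suff [d fd] : exists d, isdeg f d by exact: (xgetPex _ (ex_intro _ d fd)).
have [N fN] := bnd_ex f.
have ex : exists c : nat, f (N - c%:Z) != 0.
  apply: contrapT => /forallNP nf; move/negP: f0; apply; apply/eqP.
  apply: (@laurent_bndP N) => // c; rewrite lcoef0; apply/eqP.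
  by move/negP: (nf c); rewrite negbK.
case: (ex_minnP ex) => c fc cmin; exists (N - c%:Z); split => // k ltk.
have [kN|Nk] := leP k N; last exact: fN.
apply/eqP; apply: contraT => fk.
by have := cmin `|N - k|%N; rewrite (_ : N - _ = k) ?fk; [lia|lia].
Qed.

Lemma ldeg_eq f d : isdeg f d -> ldeg f = d.
Proof.
move=> fd; apply: isdeg_uniq (fd); apply: ldegP.
by apply/eqP => f0; case: fd; rewrite f0 eqxx.
Qed.

Lemma isdegM f g d e : isdeg f d -> isdeg g e -> isdeg (f * g) (d + e).
Proof.
move=> [fd bd] [ge be]; split; last exact: lconv_gt.
rewrite lcoefM -[d + e]subr0 (lconv_le 0 bd be) big_ord1 /= !subr0.
by rewrite mulf_neq0.
Qed.

(* The coefficients of the inverse of the power series with coefficients a. *)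
Fixpoint invseq (a : nat -> K) n : seq K := if n is m.+1 then
    rcons (invseq a m) ((a 0%N)^-1 *
      ((m == 0)%:R - \sum_(i < m) a (m - i)%N * (invseq a m)`_i))
  else [::].

Lemma size_invseq a n : size (invseq a n) = n.
Proof. by elim: n => //= n IH; rewrite size_rcons IH. Qed.

Lemma nth_invseq a n i : (i < n)%N -> (invseq a n)`_i = (invseq a i.+1)`_i.
Proof.
elim: n => // n IH; rewrite ltnS leq_eqVlt => /orP[/eqP -> //|ltin].
by rewrite [invseq a n.+1]/= nth_rcons size_invseq ltin IH.
Qed.

Lemma invseqP a c : a 0%N != 0 ->
  \sum_(i < c.+1) a (c - i)%N * (invseq a i.+1)`_i = (c == 0)%:R.
Proof.
move=> a0; rewrite big_ord_recr [(invseq a c.+1)`_c]/= subnn nth_rcons.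
rewrite size_invseq ltnn eqxx mulVKf //= addrC -[RHS]addr0 -addrA.
congr (_ + _); apply/eqP; rewrite addrC subr_eq0; apply/eqP.
by apply: eq_bigr => i _; rewrite [in RHS]nth_invseq.
Qed.

Lemma linv_ex f : f != 0 -> exists g, g * f = 1.
Proof.
move=> /ldegP; set d := ldeg f => -[fd bd].
pose a i := f (d - i%:Z).
have a0 : a 0%N != 0 by rewrite /a subr0.
pose g (k : int) := if k <= - d then
  (invseq a (absz (- d - k)).+1)`_(absz (- d - k)) else 0.
have gb : bnd (- d) g by move=> k dk; rewrite /g leNgt dk.
exists (Laurent (ex_intro _ (- d) gb)).
apply: (@laurent_bndP 0) => [||c]; last 1 first.
- rewrite lcoefM lcoef1 -[in LHS](addNr d).
  rewrite (@lconv_le _ _ (Laurent (ex_intro _ (- d) gb)) f) //=.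
  rewrite sub0r oppr_eq0 -(invseqP c a0); apply: eq_bigr => -[i /= ic] _.
  rewrite /g lerBlDr lerDl mulrC; congr (_ * _).
  by have -> : absz (- d - (- d - i%:Z))%R = i by lia.
- by rewrite -(addNr d); exact: (@lconv_gt _ _ (Laurent (ex_intro _ (- d) gb))).
- exact: bnd_lone.
Qed.

Definition linv f : laurent K :=
  if f == 0 then 0 else xget 0 [set g | g * f = 1].

Fact lmulVf f : f != 0 -> linv f * f = 1.
Proof.
move=> f0; rewrite /linv (negbTE f0).
by have [g gf] := linv_ex f0; apply: (@xgetPex _ 0 [set g | g * f = 1]); exists g.
Qed.

Fact linv0 : linv 0 = 0.
Proof. by rewrite /linv eqxx. Qed.

HB.instance Definition _ := GRing.ComNzRing_isField.Build (laurent K)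
  lmulVf linv0.

Definition poly_coef (p : {poly K}) (k : int) : K :=
  if k is Posz i then p`_i else 0.

Fact laurent_of_poly_subproof (p : {poly K}) :
  exists N : int, bnd N (poly_coef p).
Proof.
exists (size p)%:Z => -[i|i] //=; rewrite ltz_nat => pi.
by rewrite nth_default // ltnW.
Qed.
Definition laurent_of_poly (p : {poly K}) : laurent K :=
  Laurent (laurent_of_poly_subproof p).

Lemma laurent_of_polyE (p : {poly K}) (i : nat) : laurent_of_poly p i%:Z = p`_i.
Proof. by []. Qed.

Fact laurent_of_poly_additive : zmod_morphism laurent_of_poly.
Proof.
by move=> p q; apply: laurentP => -[i|i]; rewrite lcoefB /= ?coefB ?subrr.
Qed.

Fact laurent_of_poly_multiplicative : monoid_morphism laurent_of_poly.
Proof.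
split; first by apply: laurentP => -[i|i]; rewrite lcoef1 //= coef1.
move=> p q; apply: laurentP => k; rewrite lcoefM.
have pb : bnd (size p)%:Z (laurent_of_poly p).
  by move=> [i|i] //=; rewrite ltz_nat => ?; rewrite nth_default // ltnW.
have qb : bnd (size q)%:Z (laurent_of_poly q).
  by move=> [i|i] //=; rewrite ltz_nat => ?; rewrite nth_default // ltnW.
rewrite /lconv.
rewrite -(@fsbig_widen _ _ 0 +%R [set i%:Z | i in `I_(size p)] setT) //;
  last first.
  move=> [i|i] /= [_ Di]; last by rewrite mul0r.
  rewrite nth_default ?mul0r // leqNgt; apply/negP => ip.
  by apply: Di; exists i.
rewrite fsbig_image; last by move=> i j _ _ [].
rewrite -(fsbig_ord _ (size p) (fun i => p`_i * laurent_of_poly q (k - i%:Z))).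
case: k => [k|k] /=; last first.
  by rewrite big1 // => i _; rewrite (_ : Negz k - (i : nat)%:Z = Negz (k + i)%N) ?mulr0 //; lia.
rewrite coefM.
pose G i := p`_i * laurent_of_poly q (k%:Z - i%:Z).
have GE n : (k < n)%N -> (size p <= n)%N ->
    \sum_(i < size p) G i = \sum_(i < n) G i /\
    \sum_(i < k.+1) G i = \sum_(i < n) G i.
  move=> kn pn; split; rewrite (big_ord_widen n G) // big_mkcond;
    apply: eq_bigr => i _; case: ifPn => //; rewrite -leqNgt => ?.
    by rewrite /G nth_default ?mul0r.
  rewrite /G (_ : k%:Z - i%:Z = Negz (i - k).-1) ?mulr0 //; lia.
have [-> <-] := GE (k.+1 + size p)%N (leq_addr _ _) (leq_addl _ _).
by apply: eq_bigr => -[i /= ik] _; rewrite /G subzn.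
Qed.

HB.instance Definition _ := GRing.isZmodMorphism.Build {poly K} (laurent K)
  laurent_of_poly laurent_of_poly_additive.
HB.instance Definition _ := GRing.isMonoidMorphism.Build {poly K} (laurent K)
  laurent_of_poly laurent_of_poly_multiplicative.

Lemma isdeg_poly (p : {poly K}) : p != 0 ->
  isdeg (laurent_of_poly p) (size p).-1%:Z.
Proof.
move=> p0; split; first by rewrite laurent_of_polyE -lead_coefE lead_coef_eq0.
move=> [i|i] //=; rewrite ltz_nat => pi.
by rewrite nth_default // -[size p]prednK // size_poly_gt0.
Qed.

Lemma laurent_of_poly_eq0 (p : {poly K}) : (laurent_of_poly p == 0) = (p == 0).
Proof.
apply/idP/idP => [/eqP p0|/eqP ->]; last by rewrite raddf0.
by apply: contraT => /isdeg_poly[]; rewrite p0 eqxx.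
Qed.

End LaurentRing.

HB.instance Definition _ (K : fieldType) := isPointed.Build (laurent K) 0.

Section LaurentTopology.
Local Open Scope relation_scope.
Variable K : fieldType.

Definition agree (N : int) : set (laurent K * laurent K) :=
  [set fg : laurent K * laurent K | forall k, N <= k -> fg.1 k = fg.2 k].

(* Two series are close when they agree up to a large power of X^-1. Over a
   finite field this is the topology of the absolute value [lnorm] defined
   below (see [nbhs_lnorm]). *)
Definition lent : set_system (laurent K * laurent K) :=
  filter_from [set: int] agree.

Fact lent_filter : Filter lent.
Proof.
apply: filter_from_filter; first by exists 0.
move=> N M _ _; exists (Num.min N M) => // -[f g] fg; split=> k kN;
  by apply: fg; rewrite ge_min kN ?orbT.
Qed.

Fact lent_diagonal A : lent A -> diagonal `<=` A.
Proof. by move=> [N _ NA] [f g] fg; apply: NA => k _; rewrite (fg : f = g). Qed.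

Fact lent_inv A : lent A -> lent A^-1.
Proof. by move=> [N _ NA]; exists N => // -[f g] fg; apply: NA => k /fg. Qed.

Fact lent_split A : lent A -> exists2 B, lent B & B \; B `<=` A.
Proof.
move=> [N _ NA]; exists (agree N); first by exists N.
by move=> [f g] [h fh hg]; apply: NA => k Nk; rewrite (fh k Nk) (hg k Nk).
Qed.

HB.instance Definition _ := isUniform.Build (laurent K)
  lent_filter lent_diagonal lent_inv lent_split.

Lemma nbhs_laurent (f : laurent K) (A : set (laurent K)) :
  nbhs f A <-> exists N : int, forall g : laurent K,
    (forall k, N <= k -> f k = g k) -> A g.
Proof.
rewrite -nbhs_entourageE; split.
  move=> [B [N _ NB] BA]; exists N => g fg; apply: BA; apply/xsectionP.
  exact: NB.
move=> [N NA]; exists (agree N); first by exists N.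
by move=> g /xsectionP; exact: NA.
Qed.

Fact laurent_sub_continuous :
  continuous (fun x : laurent K * laurent K => x.1 - x.2).
Proof.
move=> [f g] A /nbhs_laurent[N NA].
exists ([set h : laurent K | forall k, N <= k -> f k = h k],
        [set h : laurent K | forall k, N <= k -> g k = h k]).
  by split; apply/nbhs_laurent; exists N.
by move=> [f' g'] /= [ff' gg']; apply: NA => k Nk; rewrite !lcoefB ff' ?gg'.
Qed.

HB.instance Definition _ := PreTopologicalNmodule_isTopologicalZmodule.Build
  (laurent K) laurent_sub_continuous.

Lemma mx_laurent_sub_continuous m n :
  continuous (fun x : 'M[laurent K]_(m, n) * 'M[laurent K]_(m, n) => x.1 - x.2).
Proof.
move=> [A B] U [P AP PU].
have /= cs i j := @laurent_sub_continuous (A i j, B i j) (P i j).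
have {}cs i j : exists Q : set (laurent K) * set (laurent K),
    (nbhs (A i j) Q.1 /\ nbhs (B i j) Q.2) /\
    forall x y, Q.1 x -> Q.2 y -> P i j (x - y).
  have := AP i j; rewrite !mxE => /cs[Q nQ QP]; exists Q; split => // x y Qx Qy.
  by have := QP (x, y); apply.
have [Q QP] := choice (fun ij => cs ij.1 ij.2).
exists ([set M : 'M[laurent K]_(m, n) | forall i j, (Q (i, j)).1 (M i j)],
        [set M : 'M[laurent K]_(m, n) | forall i j, (Q (i, j)).2 (M i j)]).
  split => /=.
    by exists (fun i j => (Q (i, j)).1) => // i j; have [[]] := QP (i, j).
  by exists (fun i j => (Q (i, j)).2) => // i j; have [[]] := QP (i, j).
move=> [M N] /= [QM QN]; apply: PU => i j.
by rewrite !mxE; have [_] := QP (i, j); apply.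
Qed.

End LaurentTopology.

Section LaurentNorm.
Variable F : finFieldType.
Implicit Types (f g : laurent F).

Definition lnorm {R : numFieldType} f : R :=
  if f == 0 then 0 else #|F|%:R ^ ldeg f.

Definition supnorm {R : realFieldType} r (v : 'cV[laurent F]_r) : R :=
  \big[Num.max/0]_(i < r) lnorm (v i 0).

Let card_neq0 (R : numFieldType) : #|F|%:R != 0 :> R.
Proof. by rewrite pnatr_eq0 -lt0n (ltnW (card_finNzRing_gt1 F)). Qed.

Lemma lnormE (R : numFieldType) f d : isdeg f d -> lnorm f = #|F|%:R ^ d :> R.
Proof.
move=> fd; rewrite /lnorm (ldeg_eq fd); case: eqP => // f0.
by case: fd; rewrite f0 eqxx.
Qed.

Lemma lnorm0 (R : numFieldType) : lnorm 0 = 0 :> R.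
Proof. by rewrite /lnorm eqxx. Qed.

Lemma lnorm_ge0 (R : realFieldType) f : 0 <= lnorm f :> R.
Proof. by rewrite /lnorm; case: ifP => // _; rewrite exprz_ge0. Qed.

Lemma lnorm_eq0 (R : realFieldType) f : (lnorm f == 0 :> R) = (f == 0).
Proof.
rewrite /lnorm; case: ifP => _; first by rewrite eqxx.
by rewrite expfz_eq0 (negbTE (card_neq0 _)) andbF.
Qed.

Lemma lnormM (R : realFieldType) f g : lnorm (f * g) = lnorm f * lnorm g :> R.
Proof.
have [->|/ldegP df] := eqVneq f 0; first by rewrite mul0r !lnorm0 mul0r.
have [->|/ldegP dg] := eqVneq g 0; first by rewrite mulr0 !lnorm0 mulr0.
rewrite (lnormE _ df) (lnormE _ dg) (lnormE _ (isdegM df dg)).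
by rewrite expfzDr ?card_neq0.
Qed.

Lemma lnorm_le (R : realFieldType) f (N : int) :
  (lnorm f <= #|F|%:R ^ N :> R) <-> bnd N f.
Proof.
have s1 : 1 < #|F|%:R :> R by rewrite ltr1n card_finNzRing_gt1.
have [->|f0] := eqVneq f 0.
  by rewrite lnorm0 exprz_ge0 ?ler0n //; split => // _ k.
have [fd bd] := ldegP f0; rewrite (lnormE _ (ldegP f0)) ler_eXz2l //.
split => [dN|bN]; first exact: bndW bd.
by rewrite leNgt; apply/negP => /bN; apply/eqP.
Qed.

Lemma lnorm_ultrametric (R : realFieldType) f g :
  lnorm (f + g) <= Num.max (lnorm f) (lnorm g) :> R.
Proof.
wlog fg : f g / lnorm f <= lnorm g :> R.
  move=> H; have /orP[fg|gf] := le_total (lnorm f) (lnorm g : R).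
    exact: H.
  by rewrite maxC addrC; exact: H.
rewrite (max_idPr fg).
have [g0|g0] := eqVneq g 0.
  move: fg; rewrite g0 lnorm0 le_eqVlt ltNge lnorm_ge0 orbF lnorm_eq0 => /eqP ->.
  by rewrite addr0 lnorm0.
move: fg; rewrite (lnormE _ (ldegP g0)) => /lnorm_le fb.
apply/lnorm_le => k gk; rewrite lcoefD fb // (ldegP g0).2 //.
by rewrite addr0.
Qed.

Lemma lnorm_poly (R : numFieldType) (p : {poly F}) : p != 0 ->
  lnorm (laurent_of_poly p) = (#|F| ^ (size p).-1)%:R :> R.
Proof. by move=> /isdeg_poly/lnormE ->; rewrite natrX. Qed.

Lemma nbhs_lnorm (R : realType) f (A : set (laurent F)) :
  nbhs f A <-> exists2 e : R, 0 < e & forall g, lnorm (f - g) < e -> A g.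
Proof.
have s1 : 1 < #|F|%:R :> R by rewrite ltr1n card_finNzRing_gt1.
have s0 : 0 < #|F|%:R :> R by apply: lt_trans s1.
have lnormB g N : (lnorm (f - g) <= #|F|%:R ^ N :> R) <->
    forall k, N < k -> f k = g k.
  apply: (iff_trans (lnorm_le _ _ _)); split => H k /H.
    by move/eqP; rewrite lcoefB subr_eq0 => /eqP.
  by rewrite lcoefB => ->; rewrite subrr.
split => [/nbhs_laurent[N NA]|[e e0 eA]].
  exists (#|F|%:R ^ N); first exact: exprz_gt0.
  move=> g fg; apply: NA => k Nk.
  have [->|fg0] := eqVneq f g => //.
  have /ldegP dfg : f - g != 0 by rewrite subr_eq0.
  apply/eqP; rewrite -subr_eq0 -lcoefB; apply/eqP; apply: dfg.2.
  by move: fg; rewrite (lnormE _ dfg) ltr_eXz2l // => /lt_le_trans; apply.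
have [k ke] : exists k : nat, #|F|%:R ^- k < e.
  exists (Num.bound e^-1); rewrite -[ltRHS]invrK ltf_pV2 ?posrE ?exprn_gt0 ?invr_gt0 //.
  have /archi_boundP : 0 <= e^-1 by rewrite invr_ge0 ltW.
  move/lt_le_trans; apply; rewrite -natrX ler_nat ltnW //.
  exact: ltn_expl _ (card_finNzRing_gt1 F).
apply/nbhs_laurent; exists (- k%:Z) => g fg; apply: eA.
apply: le_lt_trans ke; rewrite exprnN; apply/lnormB => j /ltW; exact: fg.
Qed.

Lemma supnorm_polyn_nat (R : realFieldType) n (q : 'cV[{poly F}]_n) :
  exists k : nat, supnorm (map_mx (@laurent_of_poly F) q) = k%:R :> R.
Proof.
apply: (big_ind (fun x : R => exists k : nat, x = k%:R)).
- by exists 0%N.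
- move=> _ _ [a ->] [b ->]; rewrite /Num.max.
  by case: ifP => _; [exists b|exists a].
- move=> i _; rewrite mxE; have [->|q0] := eqVneq (q i 0) 0.
    by exists 0%N; rewrite raddf0 lnorm0.
  by rewrite lnorm_poly //; eexists.
Qed.

Lemma truncn_supnorm (R : realType) n k (q : 'cV[{poly F}]_n) :
  (Num.truncn (supnorm (map_mx (@laurent_of_poly F) q) ^+ k : R))%:R =
  supnorm (map_mx (@laurent_of_poly F) q) ^+ k :> R.
Proof.
by have [a ->] := supnorm_polyn_nat R q; rewrite -natrX natrK.
Qed.

End LaurentNorm.

Section Haar.
Variables (R : realType) (K : fieldType) (m n : nat).

Definition borel_mx := g_sigma_algebraType (@open 'M[laurent K]_(m, n)).

(* No regularity clause is needed: when K is finite this group is locally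
   compact and second countable, so Borel measures that are finite on compact
   sets are regular. *)
Record haar_measure (mu : {measure set borel_mx -> \bar R}) : Prop := {
  haar_translate : forall (A : 'M[laurent K]_(m, n)) (B : set borel_mx),
    measurable B -> mu [set A + M | M in B] = mu B ;
  haar_compact : forall C : set 'M[laurent K]_(m, n),
    compact C -> (mu C < +oo)%E ;
  haar_neq0 : mu setT != 0%E
}.

End Haar.

(* The real number [supnorm q ^+ n] is a natural number (see [truncn_supnorm]),
   at least 1 unless q = 0; truncn only changes its type. In
   particular psi 0 only matters at q = 0. *)
Definition psi_approximable (R : realType) (F : finFieldType) (m n : nat)
    (psi : nat -> R) : set 'M[laurent F]_(m, n) :=
  [set A | infinite_set [set q : 'cV[{poly F}]_n |
     exists p : 'cV[{poly F}]_m,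
       supnorm (A *m map_mx (@laurent_of_poly F) q
                + map_mx (@laurent_of_poly F) p) ^+ m
       < psi (Num.truncn
                (supnorm (map_mx (@laurent_of_poly F) q) ^+ n : R))]].

Arguments psi_approximable {R F} m n psi.

(* Main.v *)
Require Import Defs.
From mathcomp Require Import all_boot all_order all_algebra.
From mathcomp Require Import all_classical all_reals all_analysis.
From mathcomp Require Import measurable_realfun zify ring lra.

Set Implicit Arguments.
Unset Strict Implicit.
Unset Printing Implicit Defensive.

Import Order.TTheory GRing.Theory Num.Theory.
Import numFieldNormedType.Exports.

Local Open Scope classical_set_scope.
Local Open Scope ring_scope.

Local Notation lp := (@laurent_of_poly _).

(** Write s = #|F|. Only A q modulo polynomials matters, and for q of norm s^t
    the inequality says that the first k_t fractional coefficients of every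
    coordinate of A q vanish, where k_t depends on psi (s^(n t)) only [levelP].
    For fixed nonzero q these coefficients are uniform when A runs over the unit
    ball I = cell 0 [measure_allsmall], so q is a solution with probability
    s^(- m k_t), which is comparable to min 1 (psi (s^(n t))). As about s^(n t)
    vectors have norm s^t, condensation makes the expected number of solutions
    finite exactly when the sum of psi converges.

    If the sum converges, Borel-Cantelli on each translate of I by a polynomial
    matrix concludes [solutions_null].

    If it diverges, restrict q to vectors whose first coordinate is monic of
    largest degree, and count only the primitive solutions, for which no
    nonconstant polynomial divides both q and the polynomial part of the first
    coordinate of A q. At least a quarter of the expected number survives
    [first_moment]. The decisive fact is [dichotomy]: two distinct such vectors
    either have no common primitive solution, or their fractional parts are
    jointly uniform; in both cases the probability of the conjunction is at most
    the product of the two unrestricted probabilities [pr_primsolves2]. The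
    second moment method then gives a solution among vectors of arbitrarily large
    norm with probability at least 1/32 [measure_union_lower].

    To go from positive to full measure, use that 1/32 does not depend on psi.
    Replace the levels k_t by k_(t+j) + j, for all j at once: the intersection
    over j of the corresponding sets [tailset] consists of approximable matrices,
    still fills 1/32 of I, and is invariant under translation by every matrix
    X^-N P with P polynomial, because q can be replaced by X^N q. Such
    translations are dense, so the zero-one law [zero_one] makes its complement
    null. *)

(** * Polynomial and fractional parts of Laurent series *)

Section LaurentParts.
Variable K : fieldType.
Implicit Types (f g : laurent K) (p q : {poly K}).

Lemma bnd_lp p (d : int) : (size p)%:Z <= d + 1 -> bnd d (lp p).
Proof.
move=> sp [i|i] di //=; rewrite nth_default //.
by rewrite -lez_nat; apply: le_trans sp _; lia.
Qed.

Lemma bndD N f g : bnd N f -> bnd N g -> bnd N (f + g).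
Proof. by move=> fN gN k Nk; rewrite lcoefD fN ?gN ?addr0. Qed.

Lemma bndN N f : bnd N f -> bnd N (- f).
Proof. by move=> fN k Nk; rewrite lcoefN fN ?oppr0. Qed.

Lemma bndM N M f g : bnd N f -> bnd M g -> bnd (N + M) (f * g).
Proof. exact: lconv_gt. Qed.

Lemma bndM_lp N f p : bnd N f -> bnd (N + (size p)%:Z - 1) (f * lp p).
Proof.
by move=> fN; rewrite -addrA; apply: bndM => //; apply: bnd_lp; rewrite subrK.
Qed.

Lemma bnd_sum N (I : finType) (G : I -> laurent K) :
  (forall i, bnd N (G i)) -> bnd N (\sum_i G i).
Proof.
move=> GN; apply: (big_ind (fun f : laurent K => bnd N f)) => //.
by move=> f g; exact: bndD.
Qed.

Lemma bnd_div N f p : p != 0 -> bnd N f ->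
  bnd (N - (size p).-1%:Z) (f / lp p).
Proof.
move=> p0 fN; have p0' : lp p != 0 by rewrite laurent_of_poly_eq0.
have [->|f0] := eqVneq f 0; first by rewrite mul0r.
have g0 : f / lp p != 0 by rewrite mulf_neq0 // invr_eq0.
have [_] := ldegP g0; apply: bndW; rewrite lerBrDr.
have [+ _] := isdegM (ldegP g0) (isdeg_poly p0); rewrite divfK //.
by apply: contra_neqT; rewrite -ltNge; exact: fN.
Qed.

Lemma lcoefXn N f k : (lp 'X^N * f) k = f (k - N%:Z).
Proof.
rewrite lcoefM /lconv -(fsbig_widen [set N%:Z] setT) //; last first.
  move=> [i|i] /= [_ iN]; last by rewrite mul0r.
  rewrite coefXn; case: eqP => [iN'|_]; last by rewrite mul0r.
  by case: iN; rewrite iN'.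
by rewrite fsbig_set1 /= coefXn eqxx mul1r.
Qed.

(** Coefficients of nonnegative index; the size bound also works for f = 0, whose
    degree has no meaning. *)
Definition lpol f : {poly K} := \poly_(i < `|ldeg f|.+1) f i%:Z.

Lemma coef_lpol f i : (lpol f)`_i = f i%:Z.
Proof.
rewrite coef_poly; case: ifPn => //; rewrite -leqNgt => ki.
have [->|f0] := eqVneq f 0; first by rewrite lcoef0.
by have [_ ->] := ldegP f0 => //; lia.
Qed.

Lemma lpolD f g : lpol (f + g) = lpol f + lpol g.
Proof. by apply/polyP => i; rewrite coefD !coef_lpol. Qed.

Lemma lpol_lp p : lpol (lp p) = p.
Proof. by apply/polyP => i; rewrite coef_lpol. Qed.

Lemma lpol_bnd f : bnd (-1) f -> lpol f = 0.
Proof. by move=> f1; apply/polyP => i; rewrite coef_lpol coef0 f1. Qed.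

Lemma bnd_lfrac f : bnd (-1) (f - lp (lpol f)).
Proof. by case=> [i|i] // _; rewrite lcoefB /= coef_lpol subrr. Qed.

(** The distance from f to the polynomials is at most s^(-k-1): the
    coefficients of X^-1, ..., X^-k vanish. *)
Definition small (k : nat) f := forall i, (i < k)%N -> f (Negz i) = 0.

Lemma smallD k f g : small k f -> small k g -> small k (f + g).
Proof. by move=> fk gk i ik; rewrite lcoefD fk ?gk ?addr0. Qed.

Lemma small_bnd k f : bnd (Negz k) f -> small k f.
Proof. by move=> fk i ik; apply: fk; rewrite ltNge; lia. Qed.

Lemma small_frac k f : small k f <-> bnd (Negz k) (f - lp (lpol f)).
Proof.
split=> [fk|fk]; last first.
  by rewrite -[f](subrK (lp (lpol f))); apply: smallD => //; exact: small_bnd.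
case=> [i|i] ik; first by rewrite bnd_lfrac.
by rewrite lcoefB /= subr0 fk //; lia.
Qed.

Lemma small_Xn k N f : small (k + N)%N f -> small k (lp 'X^N * f).
Proof.
move=> fk i ik; rewrite lcoefXn.
have -> : Negz i - N%:Z = Negz (i + N)%N by rewrite !NegzE; lia.
by apply: fk; rewrite ltn_add2r.
Qed.

End LaurentParts.

(** * Two simultaneous approximations *)

Section Dichotomy.
Variable K : fieldType.
Implicit Types (f g v w x y : laurent K) (p : {poly K}).

(** If y = p + e and y' = p' + e' with p, p' polynomials and e, e' small, then
    b p - a p' = a e' - b e. A nonzero polynomial has norm at least 1, so a or
    b must be large enough to compensate for the smallness of e' or e. *)
Lemma small_cross k l (a b : {poly K}) y y' :
  lp b * y = lp a * y' -> small k y -> small l y' ->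
  b * lpol y != a * lpol y' ->
  (l < (size a).-1)%N \/ (k < (size b).-1)%N.
Proof.
move=> yy' /small_frac yk /small_frac yl nab.
apply: contrapT => /not_orP[/negP al /negP bk].
move/eqP: nab; apply.
have [a0|a0] := eqVneq a 0.
  move/eqP: yy'; rewrite a0 raddf0 !mul0r mulf_eq0 laurent_of_poly_eq0.
  case/orP => /eqP ->; first by rewrite mul0r.
  by rewrite (_ : lpol 0 = 0) ?mulr0 // -[0 in LHS](raddf0 lp) lpol_lp.
have [b0|b0] := eqVneq b 0.
  move/esym/eqP: yy'; rewrite b0 raddf0 !mul0r mulf_eq0 laurent_of_poly_eq0.
  case/orP => /eqP ->; first by rewrite mul0r.
  by rewrite (_ : lpol 0 = 0) ?mulr0 // -[0 in LHS](raddf0 lp) lpol_lp.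
apply/eqP; rewrite -subr_eq0 -[_ - _]lpol_lp lpol_bnd //.
have -> : lp (b * lpol y - a * lpol y') =
    (y' - lp (lpol y')) * lp a - (y - lp (lpol y)) * lp b.
  rewrite rmorphB !rmorphM !mulrBl (mulrC y') (mulrC y) yy'.
  ring.
apply: bndD; last apply: bndN.
- by apply: (bndW _ (bndM_lp yl)); move: a0; rewrite -size_poly_gt0; lia.
- by apply: (bndW _ (bndM_lp yk)); move: b0; rewrite -size_poly_gt0; lia.
Qed.

Definition matches k y v := small k (y - v).

Lemma matches_refl k v : matches k v v.
Proof. by move=> i _; rewrite subrr. Qed.

(** Choose a z = v + h + e / b with h a polynomial. The term e / b, with e a
    fractional part, does not affect the first k coefficients because b has
    large degree. In b z, the values of b h / a modulo polynomials run through
    all the multiples of 1 / a, since a and b are coprime, and e / a fills the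
    gaps between them, so that w can be reached exactly. *)
Lemma matches_coprime k l (a b : {poly K}) v w :
  coprimep a b -> a != 0 -> (k < (size b).-1)%N ->
  exists z, matches k (lp a * z) v /\ matches l (lp b * z) w.
Proof.
move=> cab a0 kb.
have b0 : b != 0 by rewrite -size_poly_gt0; lia.
have la0 : lp a != 0 by rewrite laurent_of_poly_eq0.
have lb0 : lp b != 0 by rewrite laurent_of_poly_eq0.
(* u / a is the value still missing in b z once a z matches v. *)
pose u := lp a * w - lp b * v.
have [h [r [hr]]] : exists h r, b * h = lpol u + a * r /\ True.
  have /Bezout_eq1_coprimepP[[c1 c2] /= cE] := cab.
  exists (lpol u * c2), (- (lpol u * c1)); split=> //.
  rewrite -[X in _ = X + _]mulr1 -cE; ring.
move=> _.
pose e := u - lp (lpol u).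
exists ((v + lp h + e / lp b) / lp a); split.
  rewrite mulrC divfK // /matches (_ : _ - v = lp h + e / lp b); last by ring.
  apply: smallD => //; apply: small_bnd.
  by apply: (bndW _ (bnd_div b0 (bnd_lfrac u))); lia.
have -> : lp b * ((v + lp h + e / lp b) / lp a) = w + lp r.
  have : lp (b * h) = lp (lpol u + a * r) by rewrite hr.
  rewrite rmorphM rmorphD rmorphM => bh.
  apply: (mulIf la0); rewrite mulrA divfK //.
  rewrite !mulrDr bh mulrCA divff // mulr1 /e /u.
  ring.
by rewrite /matches addrAC subrr add0r.
Qed.

Section Rows.
Variables (m n : nat).
Implicit Types (A : 'M[laurent K]_(m, n)) (q : 'cV[{poly K}]_n).

Definition ev A q : 'cV[laurent K]_m := A *m map_mx lp q.

Lemma evE A q i : ev A q i 0 = \sum_j A i j * lp (q j 0).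
Proof. by rewrite mxE; apply: eq_bigr => j _; rewrite mxE. Qed.

Lemma evD A B q : ev (A + B) q = ev A q + ev B q.
Proof. exact: mulmxDl. Qed.

Lemma evD_entry A B q i : ev (A + B) q i 0 = ev A q i 0 + ev B q i 0.
Proof. by rewrite evD mxE. Qed.

Lemma evZ A q p : ev A (p *: q) = lp p *: ev A q.
Proof. by rewrite /ev map_mxZ -scalemxAr. Qed.

Definition primitive (p : {poly K}) q :=
  forall d, d %| p -> (forall j, d %| q j 0) -> (size d <= 1)%N.

End Rows.

Lemma ev_delta n j (c : laurent K) (q : 'cV[{poly K}]_n) :
  @ev 1 n (c *: delta_mx 0 j) q 0 0 = c * lp (q j 0).
Proof.
rewrite evE (bigD1 j) //= big1 => [|i /negPf ij]; rewrite !mxE !eqxx ?ij /=.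
  by rewrite mulr1 addr0.
by rewrite mulr0 mul0r.
Qed.

Lemma cV_neq0 n (q : 'cV[{poly K}]_n) : q != 0 -> exists j, q j 0 != 0.
Proof.
move=> q0; apply: contrapT => /forallNP nq; move/eqP: q0; apply.
by apply/matrixP => j i; rewrite ord1 mxE; apply/eqP/negPn/negP; exact: nq.
Qed.

Lemma ev_onto n (q : 'cV[{poly K}]_n) v : q != 0 ->
  exists x : 'rV[laurent K]_n, ev x q 0 0 = v.
Proof.
move=> q0; have [j qj] := cV_neq0 q0.
exists ((v / lp (q j 0)) *: delta_mx 0 j).
by rewrite ev_delta divfK // laurent_of_poly_eq0.
Qed.

Lemma ev_rows m n (x : 'I_m -> 'rV[laurent K]_n) (q : 'cV[{poly K}]_n) i :
  ev (\matrix_(i, j) x i 0 j) q i 0 = ev (x i) q 0 0.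
Proof. by rewrite !evE; apply: eq_bigr => j _; rewrite mxE. Qed.

Lemma monic_unit_eq (g a b : {poly K}) : (size a <= 1)%N -> (size b <= 1)%N ->
  a * g \is monic -> b * g \is monic -> a = b.
Proof.
move=> /size1_polyC -> /size1_polyC -> /monicP + /monicP.
rewrite !lead_coefM !lead_coefC => ag bg; congr _%:P.
have g0 : lead_coef g != 0.
  by apply: contra_eq_neq ag => ->; rewrite mulr0 eq_sym oner_eq0.
by apply: (mulIf g0); rewrite ag bg.
Qed.

(** The hypotheses on A say that q and r are both primitive solutions for A.
    If q and r are linearly independent, Cramer's rule solves both conditions
    exactly. Otherwise write q_0 = a g and r_0 = b g with g the gcd: either the
    cross difference b p - a p' of the polynomial parts is nonzero, and
    [small_cross] and [matches_coprime] apply, or it is zero, and then a and b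
    divide p, q and p', r, so that primitivity makes a and b constant and
    q = r. Hence two events either exclude each other or are independent. *)
Theorem dichotomy n k l (q r : 'cV[{poly K}]_n.+1) (A : 'rV[laurent K]_n.+1) :
  q 0 0 \is monic -> r 0 0 \is monic -> q != r ->
  small k (ev A q 0 0) -> primitive (lpol (ev A q 0 0)) q ->
  small l (ev A r 0 0) -> primitive (lpol (ev A r 0 0)) r ->
  forall v w, exists x : 'rV[laurent K]_n.+1,
    matches k (ev x q 0 0) v /\ matches l (ev x r 0 0) w.
Proof.
move=> mq mr qr sq pq sr pr v w.
have lp_neq0 (p : {poly K}) : p != 0 -> lp p != 0 by rewrite laurent_of_poly_eq0.
have ev_delta2 i j (c d : laurent K) (s : 'cV[{poly K}]_n.+1) :
    @ev 1 _ (c *: delta_mx 0 i + d *: delta_mx 0 j) s 0 0 =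
    c * lp (s i 0) + d * lp (s j 0).
  by rewrite evD [LHS]mxE !ev_delta.
have [[j minor]|dep] := pselect (exists j, q 0 0 * r j 0 != q j 0 * r 0 0).
  pose D := lp (q 0 0) * lp (r j 0) - lp (q j 0) * lp (r 0 0).
  have D0 : D != 0 by rewrite /D -!rmorphM -rmorphB lp_neq0 // subr_eq0.
  (* Cramer's rule, with entries only in columns 0 and j. *)
  exists (((v * lp (r j 0) - w * lp (q j 0)) / D) *: delta_mx 0 0 +
          ((w * lp (q 0 0) - v * lp (r 0 0)) / D) *: delta_mx 0 j).
  rewrite !ev_delta2; split.
    rewrite [X in matches _ X _](_ : _ = v); first exact: matches_refl.
    by rewrite /D; field; rewrite -/D D0.
  rewrite [X in matches _ X _](_ : _ = w); first exact: matches_refl.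
  by rewrite /D; field; rewrite -/D D0.
have {}dep j : q 0 0 * r j 0 = q j 0 * r 0 0.
  by apply/eqP; apply: contrapT => /negP ?; apply: dep; exists j.
pose g := gcdp (q 0 0) (r 0 0); pose a := q 0 0 %/ g; pose b := r 0 0 %/ g.
have q0 := monic_neq0 mq; have r0 := monic_neq0 mr.
have ag : q 0 0 = a * g by rewrite divpK // dvdp_gcdl.
have bg : r 0 0 = b * g by rewrite divpK // dvdp_gcdr.
have g0 : g != 0 by apply: contraNneq q0 => g0; rewrite ag g0 mulr0.
have a0 : a != 0 by apply: contraNneq q0 => a0; rewrite ag a0 mul0r.
have b0 : b != 0 by apply: contraNneq r0 => b0; rewrite bg b0 mul0r.
have cab : coprimep a b by apply: coprimep_div_gcd; rewrite q0.
have depab j : b * q j 0 = a * r j 0.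
  by apply: (mulIf g0); rewrite [LHS]mulrAC [RHS]mulrAC -ag -bg dep mulrC.
have cross : lp b * ev A q 0 0 = lp a * ev A r 0 0.
  rewrite !evE !mulr_sumr; apply: eq_bigr => j _.
  by rewrite mulrCA -rmorphM depab rmorphM mulrCA.
have onto z : (matches k (lp a * z) v /\ matches l (lp b * z) w) ->
    exists x : 'rV[laurent K]_n.+1,
      matches k (ev x q 0 0) v /\ matches l (ev x r 0 0) w.
  move=> zP; exists ((z / lp g) *: delta_mx 0 0).
  rewrite !ev_delta ag bg !rmorphM ![lp _ * lp g]mulrC !mulrA divfK ?lp_neq0 //.
  by rewrite ![z * _]mulrC.
have nab : b * lpol (ev A q 0 0) != a * lpol (ev A r 0 0).
  apply/eqP => eab.
  have a1 : (size a <= 1)%N.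
    apply: pq => [|j]; rewrite -(Gauss_dvdpr _ cab) ?eab ?depab dvdp_mulr //.
  have b1 : (size b <= 1)%N.
    by apply: pr => [|j]; rewrite coprimep_sym in cab;
      rewrite -(Gauss_dvdpr _ cab) -?eab -?depab dvdp_mulr.
  have ab : a = b.
    by apply: (@monic_unit_eq g) => //; rewrite -?ag -?bg.
  move/eqP: qr; apply; apply/matrixP => j i; rewrite ord1.
  by apply: (mulfI b0); rewrite depab ab.
have [la|kb] := small_cross cross sq sr nab; last first.
  by have [z zP] := matches_coprime l v w cab a0 kb; exact: onto zP.
rewrite coprimep_sym in cab.
by have [z [z1 z2]] := matches_coprime k w v cab b0 la; exact: onto (conj z2 z1).
Qed.

End Dichotomy.

(** * Cosets of the balls, and compactness of the unit ball *)

Section MatrixTopology.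
Variables (K : fieldType) (m n : nat).
Local Notation mx := 'M[laurent K]_(m, n).
Implicit Types (A B C : mx) (S : set mx).

(** The matrices of norm at most s^(-N-1), where s = #|K| when K is finite; cell 0
    is a fundamental domain modulo polynomial matrices. *)
Definition cell (N : nat) : set mx :=
  [set A : mx | forall i j (k : int), - N%:Z <= k -> A i j k = 0].

Lemma cell0 N : cell N 0.
Proof. by move=> i j k _; rewrite mxE. Qed.

Lemma cellD N A B : cell N A -> cell N B -> cell N (A + B).
Proof. by move=> AN BN i j k Nk; rewrite mxE lcoefD AN ?BN ?addr0. Qed.

Lemma cellN N A : cell N A -> cell N (- A).
Proof. by move=> AN i j k Nk; rewrite mxE lcoefN AN ?oppr0. Qed.

Lemma cellB N A B : cell N A -> cell N B -> cell N (A - B).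
Proof. by move=> AN BN; apply: cellD => //; exact: cellN. Qed.

Lemma cellW N N' : (N <= N')%N -> cell N' `<=` cell N.
Proof. by move=> NN' A AN i j k Nk; apply: AN; lia. Qed.

Lemma cell_bnd N A i j : cell N A -> bnd (Negz N) (A i j).
Proof. by move=> AN k Nk; apply: AN; lia. Qed.

Lemma nbhs_cell A S : nbhs A S <-> exists N, forall B, cell N B -> S (A + B).
Proof.
split=> [[P AP PS]|[N NS]]; last first.
  exists (fun i j => [set g | forall k, - N%:Z <= k -> A i j k = g k]).
    by move=> i j; apply/nbhs_laurent; exists (- N%:Z).
  move=> B /= AB; rewrite -[B](subrK A) addrC; apply: NS => i j k Nk.
  by rewrite !mxE lcoefB -AB // subrr.
have {}AP i j : exists N : nat, forall g : laurent K,
    (forall k, - N%:Z <= k -> A i j k = g k) -> P i j g.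
  have [N NP] := (nbhs_laurent _ _).1 (AP i j); exists `|N|%N => g Ag.
  by apply: NP => k Nk; apply: Ag; lia.
have [N NP] := choice (fun ij => AP ij.1 ij.2).
exists (\max_ij N ij)%N => B BN; apply: PS => i j.
apply: (NP (i, j)) => k Nk; rewrite mxE lcoefD BN ?addr0 //.
by apply: le_trans Nk; rewrite lerN2 lez_nat (leq_bigmax (i, j)).
Qed.

Lemma open_cell S :
  (forall A, S A -> exists N, forall B, cell N B -> S (A + B)) -> open S.
Proof.
by move=> SN; rewrite openE => A /SN[N NS]; apply/nbhs_cell; exists N.
Qed.

Definition coset A N : set mx := [set B | cell N (B - A)].

Lemma open_coset A N : open (coset A N).
Proof.
apply: open_cell => B AB; exists N => C CN; rewrite /coset /= addrAC.
exact: cellD.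
Qed.

Lemma coset0 N : coset 0 N = cell N.
Proof. by apply/seteqP; split=> B; rewrite /coset /= subr0. Qed.

Lemma coset_eq A B N : cell N (B - A) -> coset A N = coset B N.
Proof.
move=> AB; apply/seteqP; split=> C; rewrite /coset /= => AC.
  have -> : C - B = (C - A) - (B - A) by rewrite opprB addrA subrK.
  exact: cellB.
have -> : C - A = (C - B) + (B - A) by rewrite addrA subrK.
exact: cellD.
Qed.

(** As N and P vary, these matrices form a dense subgroup, countable when K is. *)
Definition Xdiv_mx N (P : 'M[{poly K}]_(m, n)) : mx :=
  \matrix_(i, j) (lp (P i j) / lp 'X^N).

Lemma Xdiv_mxM N P i j : lp 'X^N * Xdiv_mx N P i j = lp (P i j).
Proof.
by rewrite mxE mulrC divfK // laurent_of_poly_eq0 monic_neq0 // monicXn.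
Qed.

Lemma Xdiv_mx_coef N P i j k : Xdiv_mx N P i j (k - N%:Z) = lp (P i j) k.
Proof. by rewrite -lcoefXn Xdiv_mxM. Qed.

Lemma Xdiv_mxN N P : Xdiv_mx N (- P) = - Xdiv_mx N P.
Proof. by apply/matrixP => i j; rewrite !mxE rmorphN mulNr. Qed.

Definition Xdiv_part N A : 'M[{poly K}]_(m, n) :=
  \matrix_(i, j) lpol (lp 'X^N * A i j).

Lemma Xdiv_partP N A : cell N (A - Xdiv_mx N (Xdiv_part N A)).
Proof.
move=> i j k Nk; rewrite mxE [X in _ + X]mxE lcoefD lcoefN.
rewrite -[k](addrK N%:Z) Xdiv_mx_coef mxE.
have [d ->] : exists d : nat, k + N%:Z = d%:Z by exists `|(k + N%:Z)%R|%N; lia.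
by rewrite laurent_of_polyE coef_lpol lcoefXn subrr.
Qed.

Definition is_Xdiv A := exists N P, A = Xdiv_mx N P.

Lemma coset_Xdiv A N : coset A N = coset (Xdiv_mx N (Xdiv_part N A)) N.
Proof.
by apply: coset_eq; rewrite -opprB; apply: cellN; exact: Xdiv_partP.
Qed.

End MatrixTopology.

Section Compactness.
Variables (F : finFieldType) (m n : nat).

(** An ultrafilter on cell 0 selects one value for each coefficient, because F
    is finite; these values are the coefficients of its limit. *)
Lemma compact_cell0 : compact (@cell F m n 0).
Proof.
rewrite compact_ultra => G GU G0.
have ex (x : 'I_m * 'I_n * int) : exists c : F,
    G [set A : 'M[laurent F]_(m, n) | A x.1.1 x.1.2 x.2 = c].
  apply: contrapT => /forallNP nG.
  have /filter_ex[A] : G [set A : 'M[laurent F]_(m, n) |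
      forall c : F, A x.1.1 x.1.2 x.2 <> c].
    by apply: filter_forall => c;
      have [/nG|] := in_ultra_setVsetC
        (fun A : 'M[laurent F]_(m, n) => A x.1.1 x.1.2 x.2 = c) GU.
  by move=> /(_ _ erefl).
have [c cP] := choice ex.
have cb i j : exists N : int, bnd N (fun k : int => if k < 0 then c (i, j, k) else 0).
  by exists 0 => k /ltW; rewrite leNgt => /negPf ->.
pose A0 : 'M[laurent F]_(m, n) := \matrix_(i, j) Laurent (cb i j).
exists A0; split => [i j k|S /nbhs_cell[N NS]].
  by rewrite oppr0 mxE leNgt /= => /negPf ->.
have GN : G [set A : 'M[laurent F]_(m, n) |
    forall x : 'I_m * 'I_n * 'I_N, A x.1.1 x.1.2 (Negz x.2) = c (x.1, Negz x.2)].
  by apply: filter_forall => x; exact: (cP (x.1, Negz x.2)).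
apply: filterS (filterI G0 GN) => A [A0A AN].
rewrite -[A](subrK A0) addrC; apply: NS => i j k Nk.
rewrite !mxE lcoefB; have [k0|k0] := leP 0 k.
  by rewrite A0A //= ltNge k0 subrr.
have kN : (`|k|.-1 < N)%N by lia.
have := AN ((i, j), Ordinal kN) => /=.
have -> : Negz `|k|.-1 = k by lia.
by move=> ->; rewrite k0 subrr.
Qed.

End Compactness.

(** * Counting functions of finite families of events *)

Lemma sume_cst (R : realType) (I : Type) (r : seq I) (x : \bar R) :
  (\sum_(i <- r) x = (size r)%:R%:E * x)%E.
Proof.
elim: r => [|i r IH]; first by rewrite big_nil mul0e.
rewrite big_cons IH -[X in (X + _)%E]mul1e -ge0_muleDl ?lee_fin //.
by rewrite -EFinD nat1r.
Qed.

Section Counting.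
Context d (T : measurableType d) (R : realType).
Variables (mu : {measure set T -> \bar R}) (D : set T).
Hypothesis mD : measurable D.
Variables (I : eqType) (r : seq I) (E : I -> set T).
Hypothesis mE : forall i, measurable (E i).

Let count (x : T) : R := \sum_(i <- r) \1_(E i) x.

Let measurable_count : measurable_fun D ((fun x => (count x)%:E) : T -> \bar R).
Proof.
apply/measurable_EFinP; apply: measurable_sum => i.
exact: measurable_indic.
Qed.

Let count_ge0 x : 0 <= count x.
Proof. by apply: sumr_ge0 => i _; rewrite indicE. Qed.

Let integral_count :
  (\int[mu]_(x in D) (count x)%:E = \sum_(i <- r) mu (E i `&` D))%E.
Proof.
under eq_integral do rewrite /count -sumEFin.
rewrite ge0_integral_sum //; last first.
  by move=> i; apply/measurable_EFinP; exact: measurable_indic.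
by apply: eq_bigr => i _; rewrite integral_indic.
Qed.

Let integral_count2 :
  (\int[mu]_(x in D) (count x * count x)%:E =
   \sum_(i <- r) \sum_(j <- r) mu (E i `&` E j `&` D))%E.
Proof.
transitivity (\int[mu]_(x in D)
    \sum_(i <- r) \sum_(j <- r) (\1_(E i `&` E j) x)%:E)%E.
  apply: eq_integral => x _; rewrite /count mulr_suml -sumEFin.
  apply: eq_bigr => i _; rewrite mulr_sumr -sumEFin.
  by apply: eq_bigr => j _; rewrite indicI.
have mI i j : measurable_fun D ((fun x => (\1_(E i `&` E j) x)%:E) : T -> \bar R).
  by apply/measurable_EFinP; apply: measurable_indic; exact: measurableI.
rewrite ge0_integral_sum //; last 2 first.
  by move=> i; exact: emeasurable_sum.
  by move=> i x _; apply: sume_ge0 => j _; rewrite lee_fin indicE.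
apply: eq_bigr => i _; rewrite ge0_integral_sum //.
by apply: eq_bigr => j _; rewrite integral_indic //; exact: measurableI.
Qed.

(** Integrate the constant function 1, which is the number of events that occur. *)
Lemma measure_partition :
  (forall x, D x -> exists2 i, i \in r & forall j, j \in r -> E j x <-> j = i) ->
  uniq r -> (\sum_(i <- r) mu (E i `&` D) = mu D)%E.
Proof.
move=> part ur; rewrite -integral_count -[RHS]mul1e.
rewrite -integral_cst //; apply: eq_integral => x; rewrite inE => /part[i ir iP].
congr _%:E; rewrite /count (bigD1_seq i) //= big_seq_cond big1 ?addr0.
  by rewrite indicE mem_set //; exact/(iP i ir).
move=> j /andP[jr ji]; rewrite indicE memNset // => // /(iP j jr)/eqP.
by rewrite (negPf ji).
Qed.

Lemma measure_cover A : measurable A ->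
  (forall x, D x -> A x -> exists2 i, i \in r & E i x) ->
  (mu (A `&` D) <= \sum_(i <- r) mu (E i `&` D))%E.
Proof.
move=> mA cov; rewrite -integral_count -integral_indic //.
apply: ge0_le_integral => //.
  by apply/measurable_EFinP; exact: measurable_indic.
move=> x Dx; rewrite lee_fin indicE; have [/set_mem Ax|_] := boolP (x \in A) => //.
have [i ir Ei] := cov x Dx Ax.
rewrite /count (big_rem i) //= indicE mem_set // lerDl.
by apply: sumr_ge0 => j _; rewrite indicE.
Qed.

(** Integrate 2 lam Z <= 1_A + lam^2 Z^2, where Z is the number of events that
    occur. It holds because (1 - lam Z)^2 >= 0 on A and Z = 0 outside A. *)
Lemma second_moment A (lam : R) : measurable A -> 0 <= lam ->
  (forall i x, i \in r -> D x -> E i x -> A x) ->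
  ((2 * lam)%:E * (\sum_(i <- r) mu (E i `&` D)) <=
   mu (A `&` D) +
   (lam ^+ 2)%:E * \sum_(i <- r) \sum_(j <- r) mu (E i `&` E j `&` D))%E.
Proof.
move=> mA lam0 sub.
have mc2 : measurable_fun D ((fun x => (count x * count x)%:E) : T -> \bar R).
  apply/measurable_EFinP; apply: measurable_funM; exact/measurable_EFinP.
have mAi : measurable_fun D ((fun x => (\1_A x)%:E) : T -> \bar R).
  by apply/measurable_EFinP; exact: measurable_indic.
rewrite -integral_count -integral_count2 -(integral_indic mu mD mA).
have c0 x : D x -> (0 <= (count x)%:E)%E by rewrite lee_fin.
have cc0 x : D x -> (0 <= (count x * count x)%:E)%E.
  by rewrite lee_fin mulr_ge0.
have Zc0 x : D x -> (0 <= (2 * lam)%:E * (count x)%:E)%E.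
  by move=> _; rewrite -EFinM lee_fin !mulr_ge0.
have Zcc0 x : D x -> (0 <= (lam ^+ 2)%:E * (count x * count x)%:E)%E.
  by move=> _; rewrite -EFinM lee_fin !mulr_ge0 ?exprn_ge0.
have mZcc : measurable_fun D
    ((fun x => (lam ^+ 2)%:E * (count x * count x)%:E)%E : T -> \bar R).
  exact: measurable_funeM.
rewrite -!ge0_integralZl ?lee_fin ?mulr_ge0 ?exprn_ge0 // -ge0_integralD //.
apply: ge0_le_integral => //.
- exact: measurable_funeM.
- exact: emeasurable_funD.
move=> x Dx; rewrite -!EFinM -EFinD lee_fin indicE.
have [_|/negP nA] := boolP (x \in A).
  rewrite -subr_ge0; have -> : 1%:R + lam ^+ 2 * (count x * count x) -
    2 * lam * count x = (1 - lam * count x) ^+ 2 by ring.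
  exact: sqr_ge0.
have -> : count x = 0.
  rewrite /count big_seq big1 // => i ir; rewrite indicE memNset // => Ei.
  by apply: nA; rewrite inE; exact: sub Ei.
by rewrite !mulr0 addr0.
Qed.

End Counting.

(** * Equidistribution along translations *)

Section Borel.
Variables (R : realType) (F : finFieldType) (m n : nat).
Local Notation mx := 'M[laurent F]_(m, n).
Local Notation T := (borel_mx F m n).
Implicit Types (A B : mx) (S : set mx).

Lemma open_measurable_mx S : open S -> measurable (S : set T).
Proof. exact: sub_sigma_algebra. Qed.

Lemma measurable_cell N : measurable (cell N : set T).
Proof. by rewrite -coset0; apply: open_measurable_mx; exact: open_coset. Qed.

Definition cosets : set (set T) :=
  [set S | S = set0 \/ exists A N, S = coset A N].

(** An open set is the union of the cosets it contains, and the cosets of centre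
    X^-N P form a countable family. *)
Lemma open_sigma_cosets S : open S -> <<s cosets >> S.
Proof.
move=> oS; pose J := ('M[{poly F}]_(m, n) * nat)%type.
pose G (x : J) : set T :=
  if `[< coset (Xdiv_mx x.2 x.1) x.2 `<=` S >] then coset (Xdiv_mx x.2 x.1) x.2
  else set0.
have -> : S = \bigcup_x G x.
  apply/seteqP; split => [A SA|A [x _]]; last by rewrite /G; case: asboolP => // +; apply.
  have [N NS] : exists N, forall B, cell N B -> S (A + B).
    by apply/nbhs_cell; rewrite openE in oS; exact: oS.
  exists (Xdiv_part N A, N) => //; rewrite /G /= -coset_Xdiv asboolT.
    by rewrite /coset /= subrr; exact: cell0.
  by move=> B AB; rewrite -(subrK A B) addrC; exact: NS.
apply: (@countable_bigcupT_measurable _ (g_sigma_algebraType cosets)).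
  exact: (@countableP J).
move=> x; apply: sub_sigma_algebra; rewrite /G; case: ifP => _; last by left.
by right; exists (Xdiv_mx x.2 x.1), x.2.
Qed.

Lemma measurable_mxE : @measurable _ T = <<s cosets >>.
Proof.
apply/seteqP; split; apply: smallest_sub; try exact: smallest_sigma_algebra.
  exact: open_sigma_cosets.
by move=> _ [->|[A [N ->]]]; apply: open_measurable_mx;
  [exact: open0|exact: open_coset].
Qed.

Lemma setI_closed_cosets : setI_closed cosets.
Proof.
move=> S1 S2 [->|[A [N ->]]]; first by left; rewrite set0I.
move=> [->|[B [N' ->]]]; first by left; rewrite setI0.
have [[C [AC BC]]|nC] := pselect (coset A N `&` coset B N' !=set0); last first.
  by left; apply/seteqP; split => // C ABC; apply: nC; exists C.
right; exists C, (maxn N N'); rewrite (coset_eq AC) (coset_eq BC).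
apply/seteqP; split => D; rewrite /coset /=.
  by case=> [CD CD']; rewrite /maxn; case: ifP.
by move=> CD; split; apply: cellW CD; rewrite ?leq_maxl ?leq_maxr.
Qed.

Definition mxshift A S : set mx := [set A + B | B in S].

Lemma mxshiftE A S : mxshift A S = [set B | S (B - A)].
Proof.
apply/seteqP; split=> [_ [B SB <-]|B SB] /=; first by rewrite addrC addKr.
by exists (B - A) => //; rewrite addrC subrK.
Qed.

Section Equidistribution.
Variable nu : {measure set T -> \bar R}.

Definition invariant_by A :=
  forall S, measurable (S : set T) -> nu (mxshift A S) = nu S.

(** A translation by A carries the fibre over v0 onto the fibre over v inside
    cell 0, so the fibres have equal measure. *)
Lemma equidistribution (V : finType) (f : mx -> V) (v0 : V) :
  (exists N, forall A B, cell N B -> f (A + B) = f A) ->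
  (forall v, exists A, [/\ cell 0 A, invariant_by A &
     forall B, cell 0 B -> f (A + B) = v <-> f B = v0]) ->
  (nu (cell 0) = #|V|%:R%:E * nu ([set A | f A = v0] `&` cell 0))%E.
Proof.
move=> [N fN] trans.
have mf v : measurable ([set A | f A = v] : set T).
  apply: open_measurable_mx; apply: open_cell => A fA.
  by exists N => B BN; rewrite /= fN.
rewrite -(@measure_partition _ _ _ nu (cell 0) (measurable_cell 0) _ (enum V)
    (fun v => [set A | f A = v])) ?enum_uniq //; last first.
  by move=> A _; exists (f A); rewrite ?mem_enum // => v _; split=> ->.
have e v : nu ([set A | f A = v] `&` cell 0) = nu ([set A | f A = v0] `&` cell 0).
  have [A [A0 inv fA]] := trans v.
  rewrite -[RHS]inv; last by apply: measurableI => //; exact: measurable_cell.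
  congr (nu _); rewrite mxshiftE; apply/seteqP; split=> B [/= fB B0].
    have BA0 : cell 0 (B - A) by exact: cellB.
    by split=> //; apply/(fA _ BA0); rewrite addrC subrK.
  by rewrite -(subrK A B) addrC; split; [exact/fA/fB|exact: cellD].
under eq_bigr do rewrite e.
by rewrite sume_cst -cardE.
Qed.

(** Equidistribution of the first N fractional coefficients of all the entries. *)
Lemma measure_cell N : (forall A, is_Xdiv A -> invariant_by A) ->
  (nu (cell 0) = (#|F|^(m * n * N))%:R%:E * nu (cell N))%E.
Proof.
move=> inv; pose V := {ffun 'I_m * 'I_n * 'I_N -> F}.
pose f A : V := [ffun x : 'I_m * 'I_n * 'I_N => A x.1.1 x.1.2 (Negz x.2)].
have := @equidistribution V f [ffun=> 0].
rewrite card_ffun !card_prod !card_ord => -> //.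
- congr (_ * nu _)%E; apply/seteqP; split=> A /=; last first.
    move=> AN; split; last exact: cellW AN.
    apply/ffunP => -[[i j] k]; rewrite !ffunE; apply: AN => /=.
    by have := ltn_ord k; lia.
  move=> [/ffunP fA A0] i j [k|k] Nk; first by rewrite A0.
  have kN : (k < N)%N by lia.
  by have := fA (i, j, Ordinal kN); rewrite !ffunE.
- exists N => A B BN; apply/ffunP => -[[i j] k]; rewrite !ffunE mxE lcoefD.
  by rewrite BN ?addr0 //=; have := ltn_ord k; lia.
move=> v; pose P : 'M[{poly F}]_(m, n) := \matrix_(i, j)
  \poly_(k < N) (if insub (N - k.+1)%N is Some l then v (i, j, l) else 0).
have PE i j k : Xdiv_mx N P i j k = lp (P i j) (k + N%:Z).
  by rewrite -(Xdiv_mx_coef N) addrK.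
have vE (x : 'I_m * 'I_n * 'I_N) : Xdiv_mx N P x.1.1 x.1.2 (Negz x.2) = v x.
  case: x => [[i j] k] /=; rewrite PE.
  have -> : Negz k + N%:Z = (N - k.+1)%N by have := ltn_ord k; lia.
  rewrite laurent_of_polyE mxE coef_poly ifT; last by have := ltn_ord k; lia.
  rewrite (_ : N - (N - k.+1).+1 = k)%N; last by have := ltn_ord k; lia.
  by rewrite valK.
exists (Xdiv_mx N P); split.
- move=> i j k k0; rewrite PE.
  have [d ->] : exists d : nat, k + N%:Z = (N + d)%N by exists `|k|%N; lia.
  by rewrite laurent_of_polyE mxE nth_default // (leq_trans (size_poly _ _)) // leq_addr.
- by apply: inv; exists N, P.
- move=> B B0; split=> /ffunP fB; apply/ffunP => x; move: (fB x);
    rewrite !ffunE mxE lcoefD vE.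
    by rewrite -[RHS]addr0 => /addrI.
  by move=> ->; rewrite addr0.
Qed.

Lemma measure_coset A N : (forall B, is_Xdiv B -> invariant_by B) ->
  nu (coset A N) = nu (cell N).
Proof.
move=> inv; rewrite coset_Xdiv -[RHS](inv (Xdiv_mx N (Xdiv_part N A))).
- by rewrite mxshiftE.
- by exists N, (Xdiv_part N A).
- exact: measurable_cell.
Qed.

End Equidistribution.
End Borel.

(** * Haar measure and a zero-one law *)

Section HaarFacts.
Variables (R : realType) (F : finFieldType) (m n : nat).
Local Notation mx := 'M[laurent F]_(m, n).
Local Notation T := (borel_mx F m n).
Variable mu : {measure set T -> \bar R}.
Hypothesis haar : haar_measure mu.
Implicit Types (A B : mx) (S : set mx).

Lemma haar_invariant A : invariant_by mu A.
Proof. by move=> S mS; exact: haar_translate. Qed.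

(** The whole space is the countable union of the translates of the unit ball
    by polynomial matrices. *)
Lemma negligible_cosets S :
  (forall P, mu.-negligible (S `&` coset (Xdiv_mx 0 P) 0 : set T)) ->
  mu.-negligible (S : set T).
Proof.
move=> SP; pose G (k : nat) : set T :=
  if unpickle k is Some P then S `&` coset (Xdiv_mx 0 P) 0 else set0.
suff : mu.-negligible (\bigcup_k G k : set T).
  apply: negligibleS => A SA; exists (pickle (Xdiv_part 0 A)) => //.
  rewrite /G pickleK; split => //.
  by rewrite -coset_Xdiv /coset /= subrr; exact: cell0.
apply: negligible_bigcup => k; rewrite /G.
by case: unpickle => [P|]; [exact: SP|exact: negligible_set0].
Qed.

Lemma haar_cell0 : exists2 M : R, 0 < M & mu (cell 0) = M%:E.
Proof.
have fin : (mu (cell 0) < +oo)%E by apply: haar_compact => //; exact: compact_cell0.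
have finn : mu (cell 0) \is a fin_num by rewrite ge0_fin_numE.
exists (fine (mu (cell 0))); last by rewrite fineK.
rewrite fine_gt0 // fin andbT lt0e measure_ge0 andbT.
apply/eqP => mu0; move/eqP: (haar_neq0 haar); apply.
apply: measure_negligible; first exact: measurableT.
apply: negligible_cosets => P; rewrite setTI.
have mC : measurable (coset (Xdiv_mx 0 P) 0 : set T).
  by apply: open_measurable_mx; exact: open_coset.
apply/negligibleP => //.
apply: etrans mu0; apply: (measure_coset (nu := mu)) => B _.
exact: haar_invariant.
Qed.

Lemma haar_cell N : exists2 M : R, 0 < M & mu (cell N) = M%:E.
Proof.
have [M M0 muM] := haar_cell0.
have := measure_cell N (fun A _ => @haar_invariant A).
have : (0 <= mu (cell N))%E by [].
rewrite muM; case: (mu (cell N)) => [r| |] //.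
  rewrite lee_fin -EFinM => r0 [Mr]; exists r => //; rewrite lt_neqAle r0 andbT.
  by apply: contraTneq M0 => r00; rewrite Mr -r00 mulr0 ltxx.
move=> _; rewrite gt0_muley // lte_fin ltr0n expn_gt0.
by rewrite (ltnW (card_finNzRing_gt1 F)).
Qed.

(** The restriction of mu to S is invariant under a dense group, so it gives
    the same mass to all balls of the same radius. It is therefore a multiple of
    mu, with a positive factor; but it vanishes on the complement of S. *)
Theorem zero_one S : measurable (S : set T) ->
  (forall A B, is_Xdiv B -> S A -> S (A + B)) ->
  (0 < mu (S `&` cell 0))%E -> mu (~` S) = 0%E.
Proof.
move=> mS invS S0.
have [M M0 muM] := haar_cell0.
have m0 : measurable (cell 0 : set T) := measurable_cell 0.
have XdivN B : is_Xdiv B -> is_Xdiv (- B).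
  by move=> [N [P ->]]; exists N, (- P); rewrite Xdiv_mxN.
pose nu := mrestr mu mS.
have nuE X : nu X = mu (X `&` S) by [].
have nu_inv A : is_Xdiv A -> invariant_by nu A.
  move=> XA X mX; change (mu (mxshift A X `&` S) = mu (X `&` S)).
  rewrite -(@haar_invariant A (X `&` S)); last first.
    exact: measurableI.
  congr (mu _); rewrite !mxshiftE; apply/seteqP; split=> B [XB SB]; split => //=.
    by apply: invS => //; exact: XdivN.
  by rewrite -(subrK A B); exact: invS.
have [s s0 nus] : exists2 s : R, 0 < s & nu (cell 0) = s%:E.
  have le : (mu (S `&` cell 0) <= M%:E)%E.
    by rewrite -muM; apply: le_measure; rewrite ?inE //; exact: measurableI.
  exists (fine (mu (S `&` cell 0))).
    by rewrite fine_gt0 // S0 (le_lt_trans le) ?ltry.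
  by rewrite nuE setIC fineK // ge0_fin_numE // (le_lt_trans le) ?ltry.
have eq X : measurable (X : set T) ->
    mscale (NngNum (ltW s0)) mu X = mscale (NngNum (ltW M0)) nu X.
  pose g (k : nat) : set T := if unpickle k is Some P then coset (Xdiv_mx 0 P) 0 else set0.
  apply: (measure_unique (@cosets F m n) g) => //.
  - exact: measurable_mxE.
  - exact: setI_closed_cosets.
  - rewrite /g => k; case: unpickle => [P|]; last by left.
    by right; exists (Xdiv_mx 0 P), 0%N.
  - apply/seteqP; split => // A _; exists (pickle (Xdiv_part 0 A)) => //.
    by rewrite /g pickleK -coset_Xdiv /coset /= subrr; exact: cell0.
  - move=> _ [->|[A [N ->]]]; first by rewrite !measure0.
    change (s%:E * mu (coset A N) = M%:E * nu (coset A N))%E.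
    have -> : mu (coset A N) = mu (cell N).
      by apply: (measure_coset (nu := mu)) => B _; exact: haar_invariant.
    have -> : nu (coset A N) = nu (cell N) by exact: (measure_coset (nu := nu)).
    have [c c0 muc] := haar_cell N.
    have : (s%:E = (#|F| ^ (m * n * N))%:R%:E * nu (cell N))%E.
      by rewrite -nus; exact: (measure_cell N nu_inv).
    have := measure_cell N (fun A _ => @haar_invariant A).
    rewrite muM muc -EFinM => -[ME].
    have le : (nu (cell N) <= c%:E)%E.
      rewrite -muc nuE; apply: le_measure; rewrite ?inE //; last exact: measurable_cell.
      by apply: measurableI => //; exact: measurable_cell.
    have : (0 <= nu (cell N))%E by [].
    case: (nu (cell N)) le => [r| |] // rc r0.
    rewrite -EFinM => -[sE]; rewrite -!EFinM; congr _%:E.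
    rewrite [X in X * _ = _]sE [X in _ = X * _]ME.
    ring.
  - rewrite /g => k; case: unpickle => [P|]; last by rewrite measure0 ltry.
    change (s%:E * mu (coset (Xdiv_mx 0 P) 0) < +oo)%E.
    have -> : mu (coset (Xdiv_mx 0 P) 0) = mu (cell 0).
      by apply: (measure_coset (nu := mu)) => B _; exact: haar_invariant.
    by rewrite muM -EFinM ltry.
have : (s%:E * mu (~` S) = M%:E * mu (~` S `&` S))%E.
  exact: (eq (~` S) (measurableC mS)).
rewrite setICl measure0 mule0 => /eqP.
by rewrite mule_eq0 eqe gt_eqF //= => /eqP.
Qed.

End HaarFacts.

(** * Distribution of the fractional part of A q *)

Section EventProbabilities.
Variables (R : realType) (F : finFieldType) (m n : nat).
Local Notation mx := 'M[laurent F]_(m, n).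
Local Notation T := (borel_mx F m n).
Implicit Types (A B : mx) (q r : 'cV[{poly F}]_n)
  (y z : 'cV[laurent F]_m).

Definition allsmall k A q := forall i, small k (ev A q i 0).

Definition fcoef k (y : 'cV[laurent F]_m) : 'M[F]_(m, k) :=
  \matrix_(i, j) y i 0 (Negz j).

Lemma fcoefD k y z : fcoef k (y + z) = fcoef k y + fcoef k z.
Proof. by apply/matrixP => i j; rewrite !mxE lcoefD. Qed.

Lemma fcoef_matches k y z :
  (forall i, matches k (y i 0) (z i 0)) -> fcoef k y = fcoef k z.
Proof.
move=> yz; apply/matrixP => i j; rewrite !mxE.
by apply/eqP; rewrite -subr_eq0 -lcoefB yz.
Qed.

Lemma fcoef0 k y : fcoef k y = 0 <-> forall i, small k (y i 0).
Proof.
split=> [y0 i j jk|y0]; last first.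
  by apply/matrixP => i j; rewrite !mxE; exact: y0.
by have /matrixP/(_ i (Ordinal jk)) := y0; rewrite !mxE.
Qed.

Lemma fcoef_onto k (v : 'M[F]_(m, k)) :
  exists y : 'cV[laurent F]_m, fcoef k y = v.
Proof.
pose c i (j : int) : F :=
  if j is Negz j then (if insub j is Some l then v i l else 0) else 0.
have cb i : exists N, bnd N (c i) by exists 0; case.
exists (\col_i Laurent (cb i)); apply/matrixP => i j.
by rewrite !mxE /= valK.
Qed.

Lemma ev_cell N q : exists N', forall A, cell N' A ->
  forall i, bnd (Negz N) (ev A q i 0).
Proof.
pose d := (\max_j size (q j ord0))%N.
exists (N + d)%N => A AN i; rewrite evE; apply: bnd_sum => j.
have qd : bnd (d%:Z - 1) (lp (q j 0)).
  by apply: bnd_lp; rewrite subrK lez_nat (leq_bigmax j).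
by apply: (bndW _ (bndM (cell_bnd i j AN) qd)); lia.
Qed.

Lemma ev_poly_mx (P : 'M[{poly F}]_(m, n)) q i :
  ev (Xdiv_mx 0 P) q i 0 = lp ((P *m q) i 0).
Proof.
rewrite evE mxE rmorph_sum; apply: eq_bigr => j _.
by rewrite mxE rmorph1 divr1 rmorphM.
Qed.

Lemma fcoef_bnd k y z : (forall i, bnd (Negz k) (z i 0)) ->
  fcoef k (y + z) = fcoef k y.
Proof.
move=> zk; rewrite fcoefD (_ : fcoef k z = 0) ?addr0 //.
by apply/fcoef0 => i; exact: small_bnd.
Qed.

Lemma fcoef_poly_mx k y (P : 'M[{poly F}]_(m, n)) q :
  fcoef k (y + ev (Xdiv_mx 0 P) q) = fcoef k y.
Proof.
rewrite fcoefD (_ : fcoef k (ev _ _) = 0) ?addr0 //.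
by apply/fcoef0 => i; rewrite ev_poly_mx.
Qed.

Variable mu : {measure set T -> \bar R}.
Hypothesis haar : haar_measure mu.

(** For a map f invariant under polynomial translations, a translation that
    carries one fibre to another can be reduced to one that lies in cell 0. *)
Lemma equidistribution_periodic (V : finType) (f : mx -> V) (v0 : V) M :
  mu (cell 0) = M%:E ->
  (exists N, forall A B, cell N B -> f (A + B) = f A) ->
  (forall A P, f (A + Xdiv_mx 0 P) = f A) ->
  (forall v, exists A, forall B, f (A + B) = v <-> f B = v0) ->
  mu ([set A | f A = v0] `&` cell 0) = (M / #|V|%:R)%:E.
Proof.
move=> muM lc per onto.
have V0 : (0 < #|V|)%N by apply/card_gt0P; exists v0.
have V0' : 0 < #|V|%:R :> R by rewrite ltr0n.
have : (M%:E = #|V|%:R%:E * mu ([set A | f A = v0] `&` cell 0))%E.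
  rewrite -muM; apply: equidistribution lc _ => v; have [A fA] := onto v.
  exists (A - Xdiv_mx 0 (Xdiv_part 0 A)); split; first exact: Xdiv_partP.
    exact: haar_invariant.
  move=> B _; rewrite -(per _ (Xdiv_part 0 A)).
  by rewrite addrAC subrK; exact: fA.
have : (0 <= mu ([set A | f A = v0] `&` cell 0))%E by [].
case: (mu _) => [x| |] // x0.
  by rewrite -EFinM => -[->]; rewrite mulrAC divff ?mul1r // gt_eqF.
by rewrite gt0_muley ?lte_fin.
Qed.

Variable M : R.
Hypothesis muM : mu (cell 0) = M%:E.

Lemma measure_allsmall k q : q != 0 ->
  mu ([set A | allsmall k A q] `&` cell 0) = (M / (#|F| ^ (m * k))%:R)%:E.
Proof.
move=> q0; rewrite -(card_mx F m k).
rewrite -(@equidistribution_periodic _ (fun A => fcoef k (ev A q)) 0) //.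
- by congr (mu (_ `&` _)); apply/seteqP; split=> A /= /fcoef0.
- have [N qN] := ev_cell k q; exists N => A B BN.
  by rewrite evD fcoef_bnd //; exact: qN.
- by move=> A P; rewrite evD fcoef_poly_mx.
move=> v; have [y yv] := fcoef_onto v.
have [x xy] := choice (fun i => ev_onto (y i 0) q0).
exists (\matrix_(i, j) x i 0 j) => B.
rewrite evD fcoefD (_ : fcoef k (ev (\matrix_(i, j) _) q) = v); last first.
  rewrite -yv; congr fcoef; apply/matrixP => i j.
  by rewrite ord1 ev_rows xy.
by rewrite -[X in _ = X](addr0 v); split=> [/addrI|->].
Qed.

(** Independence of the conditions on q and r follows once both fractional parts
    can be prescribed simultaneously. *)
Lemma measure_allsmall2 k l q r :
  (forall v w, exists x : 'rV[laurent F]_n,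
     matches k (ev x q 0 0) v /\ matches l (ev x r 0 0) w) ->
  mu ([set A | allsmall k A q /\ allsmall l A r] `&` cell 0) =
  (M / (#|F| ^ (m * k) * #|F| ^ (m * l))%:R)%:E.
Proof.
move=> onto; rewrite -(card_mx F m k) -(card_mx F m l) -card_prod.
rewrite -(@equidistribution_periodic _
  (fun A => (fcoef k (ev A q), fcoef l (ev A r))) (0, 0)) //.
- congr (mu (_ `&` _)); apply/seteqP; split=> A /=.
    by move=> [/fcoef0 -> /fcoef0 ->].
  by move=> [/fcoef0 Aq /fcoef0 Ar].
- have [[N qN] [N' rN]] := (ev_cell k q, ev_cell l r).
  exists (maxn N N') => A B BN; rewrite !evD !fcoef_bnd //.
    by apply: rN; apply: cellW BN; exact: leq_maxr.
  by apply: qN; apply: cellW BN; exact: leq_maxl.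
- by move=> A P; rewrite !evD !fcoef_poly_mx.
move=> [v w]; have [[y yv] [z zw]] := (fcoef_onto v, fcoef_onto w).
have [x xy] := choice (fun i => onto (y i 0) (z i 0)).
exists (\matrix_(i, j) x i 0 j) => B.
rewrite !evD !fcoefD (_ : fcoef k (ev (\matrix_(i, j) _) q) = v); last first.
  by rewrite -yv; apply: fcoef_matches => i; rewrite ev_rows; have [] := xy i.
rewrite (_ : fcoef l (ev (\matrix_(i, j) _) r) = w); last first.
  by rewrite -zw; apply: fcoef_matches => i; rewrite ev_rows; have [] := xy i.
rewrite -[X in _ = (X, _)](addr0 v) -[X in _ = (_, X)](addr0 w).
by split=> [[/addrI -> /addrI ->]|[-> ->]].
Qed.

End EventProbabilities.

Section DivisibleEvent.
Variables (R : realType) (F : finFieldType) (m n : nat).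
Local Notation mx := 'M[laurent F]_(m.+1, n).
Local Notation T := (borel_mx F m.+1 n).
Variables (mu : {measure set T -> \bar R}) (M : R).
Hypotheses (haar : haar_measure mu) (muM : mu (cell 0) = M%:E).

(** The fractional part of A q and the residue modulo d of the polynomial part of
    its first coordinate are jointly uniform. That residue is well defined modulo
    polynomial matrices because d divides q. *)
Lemma measure_allsmall_dvd k e (d : {poly F}) (q : 'cV[{poly F}]_n) :
  q != 0 -> size d = e.+1 -> (forall j, d %| q j 0) ->
  mu ([set A : mx | allsmall k A q /\ d %| lpol (ev A q 0 0)] `&` cell 0) =
  (M / (#|F| ^ (m.+1 * k) * #|F| ^ e)%:R)%:E.
Proof.
move=> q0 sd dq; have d0 : d != 0 by rewrite -size_poly_gt0 sd.
pose res (p : {poly F}) : 'rV[F]_e := poly_rV (p %% d).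
have resD p p' : res (p + p') = res p + res p' by rewrite /res modpD linearD.
have res0 p : d %| p -> res p = 0 by move=> /eqP dp; rewrite /res dp linear0.
have resP p : res p = 0 -> d %| p.
  move/(congr1 rVpoly); rewrite poly_rV_K ?linear0 => [/eqP //|].
  by rewrite -ltnS -sd ltn_modp.
rewrite -(card_mx F m.+1 k) -[(#|F| ^ e)%N]mul1n -[e in (#|F| ^ e)%N]mul1n.
rewrite mul1n -(card_mx F 1 e) -card_prod.
rewrite -(@equidistribution_periodic _ _ _ _ _ haar _
  (fun A => (fcoef k (ev A q), res (lpol (ev A q 0 0)))) (0, 0)) //.
- congr (mu (_ `&` _)); apply/seteqP; split=> A /=.
    by move=> [/fcoef0 -> /res0 ->].
  by move=> [/fcoef0 Aq /resP].
- have [N qN] := ev_cell m.+1 k q; exists N => A B BN.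
  rewrite evD_entry evD fcoef_bnd //; last exact: qN.
  rewrite lpolD resD [lpol (ev B q 0 0)]lpol_bnd ?[res 0]res0 ?dvdp0 ?addr0 //.
  by apply: (bndW _ (qN _ BN 0)); lia.
- move=> A P; rewrite evD_entry evD fcoef_poly_mx; congr (_, _).
  rewrite lpolD resD ev_poly_mx lpol_lp [X in _ + X]res0 ?addr0 //.
  rewrite mxE; apply: (big_ind (fun p => d %| p)) => [|p p'|j _].
  - exact: dvdp0.
  - exact: dvdp_add.
  - exact: dvdp_mull.
move=> [v w]; have [y yv] := fcoef_onto v.
(* u corrects the polynomial part of row 0 without changing fractional parts. *)
pose u := rVpoly w - lpol (y 0 0).
have [x xy] := choice (fun i => ev_onto (y i 0 + lp (if i == 0 then u else 0)) q0).
exists (\matrix_(i, j) x i 0 j) => B.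
have qx : ev (\matrix_(i, j) x i 0 j) q 0 0 = y 0 0 + lp u by rewrite ev_rows xy.
rewrite evD_entry evD fcoefD (_ : fcoef k (ev (\matrix_(i, j) _) q) = v); last first.
  rewrite -yv; apply: fcoef_matches => i; rewrite ev_rows xy /matches addrAC subrr.
  by rewrite add0r.
rewrite lpolD resD qx.
rewrite (_ : res (lpol (y 0 0 + lp u)) = w); last first.
  rewrite lpolD lpol_lp addrC subrK /res modp_small ?rVpolyK //.
  by rewrite sd ltnS size_poly.
rewrite -[X in _ = (X, _)](addr0 v) -[X in _ = (_, X)](addr0 w).
by split=> [[/addrI -> /addrI ->]|[-> ->]].
Qed.

End DivisibleEvent.

(** * A family of denominators and its divisors *)

Section Family.
Variables (F : finFieldType) (n : nat).

(** The vectors whose first coordinate is monic of degree t and whose other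
    coordinates have smaller degree. *)
Definition fam t (c : 'M[F]_(n.+1, t)) : 'cV[{poly F}]_n.+1 :=
  \col_j (rVpoly (row j c) + (if j == 0 then 'X^t else 0)).

Lemma size_rVpoly t (v : 'rV[F]_t) : (size (rVpoly v) <= t)%N.
Proof. exact: size_poly. Qed.

Lemma fam_size0 t (c : 'M[F]_(n.+1, t)) : size (fam c 0 0) = t.+1.
Proof.
by rewrite mxE eqxx addrC size_polyDl size_polyXn // ltnS size_rVpoly.
Qed.

Lemma fam_monic t (c : 'M[F]_(n.+1, t)) : fam c 0 0 \is monic.
Proof.
apply/monicP; rewrite mxE eqxx addrC lead_coefDl ?lead_coefXn //.
by rewrite size_polyXn ltnS size_rVpoly.
Qed.

Lemma fam_size t (c : 'M[F]_(n.+1, t)) j : (size (fam c j 0)%R <= t.+1)%N.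
Proof.
have [->|j0] := eqVneq j 0; first by rewrite fam_size0.
by rewrite mxE (negPf j0) addr0 ltnW // ltnS size_rVpoly.
Qed.

Lemma famB t (c c' : 'M[F]_(n.+1, t)) j :
  fam c j 0 - fam c' j 0 = rVpoly (row j (c - c')).
Proof. by rewrite !mxE opprD addrACA subrr addr0 !linearB. Qed.

Lemma fam_inj t : injective (@fam t).
Proof.
move=> c c' cc'; apply/eqP; rewrite -subr_eq0; apply/eqP/row_matrixP => j.
rewrite row0; apply: (can_inj rVpolyK).
by rewrite -famB cc' subrr linear0.
Qed.

Lemma fam_neq0 t (c : 'M[F]_(n.+1, t)) : fam c != 0.
Proof.
apply: contraTneq (monic_neq0 (fam_monic c)) => ->.
by rewrite mxE eqxx.
Qed.

Definition fdvd (d : {poly F}) (q : 'cV[{poly F}]_n.+1) :=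
  [forall j, d %| q j 0].

(** Division by d is injective, and the leading coefficients of the quotients are
    known. *)
Lemma card_fam_dvd t e (d : {poly F}) : size d = e.+1 -> (e <= t)%N ->
  (#|[pred c : 'M[F]_(n.+1, t) | fdvd d (fam c)]| <= #|F| ^ (n.+1 * (t - e)))%N.
Proof.
move=> sd et; have d0 : d != 0 by rewrite -size_poly_gt0 sd.
pose f (c : 'M[F]_(n.+1, t)) : 'M[F]_(n.+1, t - e) :=
  \matrix_(j, k) (fam c j 0 %/ d)`_k.
rewrite -card_mx; apply: (@leq_card_in _ _ f).
move=> c c'; rewrite !inE => /forallP dc /forallP dc' /matrixP fcc'.
apply: fam_inj; apply/matrixP => j i; rewrite ord1.
rewrite -(divpK (dc j)) -(divpK (dc' j)); congr (_ * _).
apply/eqP; rewrite -subr_eq0; apply/negPn/negP => h0.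
have sh : (size (fam c j 0 %/ d - fam c' j 0 %/ d)%R <= t - e)%N.
  have : (size ((fam c j 0 %/ d - fam c' j 0 %/ d) * d)%R <= t)%N.
    by rewrite mulrBl !divpK // famB size_rVpoly.
  rewrite size_mul // sd addnS /= => h1. by rewrite -(leq_add2r e) subnK.
move/eqP: h0; apply; apply/polyP => k; rewrite coef0.
have [ks|sk] := ltnP k (t - e); last by rewrite nth_default // (leq_trans sh).
by have := fcc' j (Ordinal ks); rewrite !mxE /= coefB => ->; rewrite subrr.
Qed.

Definition testpoly e (w : 'rV[F]_e.+1) : {poly F} := rVpoly w + 'X^(e.+1).

(** With w the coefficients below X^(e+1), these parametrize the monic polynomials
    that are prime to X, together with all those of degree 1. With every monic
    polynomial, the union bound in [sum_test] would tend to 1 for #|F| = 2 and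
    n = 0. *)
Definition testable e (w : 'rV[F]_e.+1) := (e == 0)%N || (w 0 0 != 0).

Definition testpolys t : seq {poly F} :=
  flatten [seq [seq testpoly w | w <- enum (@testable e)] | e <- iota 0 t].

Lemma big_testpolys (R : nmodType) t (f : {poly F} -> R) :
  \sum_(d <- testpolys t) f d =
  \sum_(e < t) \sum_(w : 'rV[F]_e.+1 | testable w) f (testpoly w).
Proof.
rewrite /testpolys big_flatten big_map -(big_mkord xpredT
  (fun e => \sum_(w : 'rV[F]_e.+1 | testable w) f (testpoly w))).
rewrite /index_iota subn0; apply: eq_bigr => e _.
by rewrite big_map big_enum.
Qed.

Lemma size_testpoly e (w : 'rV[F]_e.+1) : size (testpoly w) = e.+2.
Proof. by rewrite /testpoly addrC size_polyDl size_polyXn // ltnS size_rVpoly. Qed.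

Lemma card_testable e :
  (#|@testable e| <= #|F| ^ e.+1 - (e != 0%N) * #|F| ^ e)%N.
Proof.
have [->|e0] := eqVneq e 0%N.
  by rewrite mul0n subn0 (leq_trans (max_card _)) // card_mx mul1n.
have -> : (#|F| ^ e.+1 = #|@testable e| + #|predC (@testable e)|)%N.
  by rewrite cardC card_mx mul1n.
rewrite mul1n -addnBA ?leq_addr // -[e in (_ ^ e)%N]mul1n -(card_mx F 1 e).
pose g (v : 'rV[F]_e) : 'rV[F]_e.+1 := row_mx (0 : 'rV_1) v.
have gi : injective g.
  by move=> v v' gv; have [_] := eq_row_mx (gv : row_mx (0 : 'rV_1) v = row_mx 0 v').
rewrite -(card_codom gi); apply: subset_leq_card.
apply/fintype.subsetP => _ /codomP[v ->].
rewrite !inE /testable (negPf e0) /= negbK.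
have -> : (0 : 'I_e.+1) = lshift e (0 : 'I_1) by exact: val_inj.
by have := row_mxEl (0 : 'rV[F]_1) v 0 0; rewrite [RHS]mxE => g0; apply/eqP.
Qed.

(** If a common divisor is divisible by X, take X itself; if not, its constant
    term is nonzero and the monic associate is a test polynomial. *)
Lemma nonprimitive_test t (c : 'M[F]_(n.+1, t)) p : ~ primitive p (fam c) ->
  exists2 d, d \in testpolys t & (d %| p) && fdvd d (fam c).
Proof.
move=> /existsNP[d0 /not_implyP[d0p /not_implyP[d0q /negP sd0]]].
have d00 : d0 != 0 by apply: contraNneq sd0 => ->; rewrite size_poly0.
pose d := (lead_coef d0)^-1 *: d0.
have lc0 : (lead_coef d0)^-1 != 0 by rewrite invr_eq0 lead_coef_eq0.
have md : d \is monic by rewrite monicE lead_coefZ mulVf // lead_coef_eq0.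
have dp : d %| p by rewrite dvdpZl.
have dq j : d %| fam c j 0 by rewrite dvdpZl.
have sd : (1 < size d)%N by rewrite size_scale // ltnNge.
have sdt : (size d <= t.+1)%N.
  by rewrite -(fam_size0 c) dvdp_leq // monic_neq0 // fam_monic.
have mem e (w : 'rV[F]_e.+1) : (e < t)%N -> testable w -> testpoly w \in testpolys t.
  move=> et tw; apply/flatten_mapP; exists e; first by rewrite mem_iota.
  by apply: map_f; rewrite mem_enum.
have [Xd|Xd] := boolP ('X %| d).
  exists 'X; last first.
    rewrite (dvdp_trans Xd dp); apply/forallP => j; exact: dvdp_trans Xd _.
  have -> : 'X = testpoly (0 : 'rV[F]_1) by rewrite /testpoly linear0 add0r.
  by apply: mem => //; lia.
pose e := (size d).-2.
have se : size d = e.+2 by rewrite /e; lia.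
exists d; last by rewrite dp; apply/forallP.
have sde : (size (d - 'X^(e.+1))%R <= e.+1)%N.
  apply/leq_sizeP => j ej; rewrite coefB coefXn.
  move: ej; rewrite leq_eqVlt => /predU1P[<-|ej].
    by rewrite eqxx -[d`_e.+1]/(d`_e.+2.-1) -se -lead_coefE (monicP md) subrr.
  by rewrite gtn_eqF // nth_default ?subr0 // se.
have -> : d = testpoly (poly_rV (d - 'X^(e.+1)) : 'rV[F]_e.+1).
  by rewrite /testpoly poly_rV_K // subrK.
apply: mem; first by rewrite /e; lia.
rewrite /testable mxE coefB coefXn subr0; apply/orP; right.
apply: contraNneq Xd => d0e.
by rewrite -['X]subr0 -[0]/(0%:P) dvdp_XsubCl rootE horner_coef0 d0e.
Qed.

End Family.

(** * First and second moments *)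

Section Solutions.
Variables (F : finFieldType) (m n : nat).
Local Notation mx := 'M[laurent F]_(m.+1, n.+1).
Local Notation T := (borel_mx F m.+1 n.+1).
Implicit Types (q : 'cV[{poly F}]_n.+1).

Definition solves k q : set T := [set A : mx | allsmall k A q].

Definition primsolves k q : set T :=
  [set A : mx | allsmall k A q /\ primitive (lpol (ev A q 0 0)) q].

Definition dvdsolves k q d : set T :=
  [set A : mx | allsmall k A q /\ d %| lpol (ev A q 0 0)].

Lemma measurable_ev k q (P : {poly F} -> Prop) : measurable
  ([set A : mx | allsmall k A q /\ P (lpol (ev A q 0 0))] : set T).
Proof.
apply: open_measurable_mx; apply: open_cell => A [Aq PA].
have [N qN] := ev_cell m.+1 k q; exists N => B BN; split.
  by move=> i; rewrite evD_entry; apply: smallD => //; apply: small_bnd; exact: qN.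
rewrite evD_entry lpolD [lpol (ev B q 0 0)]lpol_bnd ?addr0 //.
by apply: (bndW _ (qN _ BN 0)); lia.
Qed.

Lemma measurable_solves k q : measurable (solves k q).
Proof.
rewrite (_ : solves k q = [set A : mx | allsmall k A q /\ True]).
  exact: (measurable_ev _ _ (fun=> True)).
by apply/seteqP; split=> A // [].
Qed.

Lemma measurable_primsolves k q : measurable (primsolves k q).
Proof. exact: (measurable_ev k q (fun p => primitive p q)). Qed.

Lemma measurable_dvdsolves k q d : measurable (dvdsolves k q d).
Proof. exact: (measurable_ev k q (fun p => d %| p)). Qed.

End Solutions.

Section Moments.
Variables (R : realType) (F : finFieldType) (m n : nat).
Local Notation mx := 'M[laurent F]_(m.+1, n.+1).
Local Notation T := (borel_mx F m.+1 n.+1).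
Variables (mu : {measure set T -> \bar R}) (M : R).
Hypotheses (haar : haar_measure mu) (M0 : 0 < M) (muM : mu (cell 0) = M%:E).
Implicit Types (q r : 'cV[{poly F}]_n.+1).

Local Notation s := (#|F|%:R : R).

Let s2 : 2 <= s.
Proof. by rewrite ler_nat card_finNzRing_gt1. Qed.

Let s0 : 0 < s. Proof. by apply: lt_le_trans s2. Qed.

Definition pr (S : set T) : R := fine (mu (S `&` cell 0)).

Lemma prE (S : set T) : measurable S -> mu (S `&` cell 0) = (pr S)%:E.
Proof.
move=> mS; rewrite /pr fineK // ge0_fin_numE //.
apply: (@le_lt_trans _ _ (mu (cell 0))); last by rewrite muM ltry.
by apply: le_measure; rewrite ?inE //; [apply: measurableI => //|];
  exact: measurable_cell.
Qed.

Lemma pr_le (S S' : set T) : measurable S -> measurable S' -> S `<=` S' ->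
  pr S <= pr S'.
Proof.
move=> mS mS' SS'; rewrite -lee_fin -!prE //.
by apply: le_measure; rewrite ?inE //; [apply: measurableI => //; exact: measurable_cell..|];
   exact: setSI.
Qed.

Lemma pr_solves k q : q != 0 -> pr (solves k q) = M / s ^+ (m.+1 * k).
Proof. by move=> q0; rewrite /pr (measure_allsmall haar muM) //= natrX. Qed.

Lemma pr_dvdsolves k q (d : {poly F}) e : q != 0 -> size d = e.+1 -> fdvd d q ->
  pr (dvdsolves k q d) = M / s ^+ (m.+1 * k) / s ^+ e.
Proof.
move=> q0 sd /forallP dq; rewrite /pr (measure_allsmall_dvd haar muM _ q0 sd) //=.
by rewrite natrM !natrX invfM mulrA.
Qed.

Lemma pr_primsolves2 k l q r : q 0 0 \is monic -> r 0 0 \is monic -> q != r ->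
  pr (primsolves k q `&` primsolves l r) <= M / s ^+ (m.+1 * k) / s ^+ (m.+1 * l).
Proof.
move=> mq mr qr.
have rhs0 : 0 <= M / s ^+ (m.+1 * k) / s ^+ (m.+1 * l).
  by rewrite !divr_ge0 ?exprn_ge0 // ltW.
have [[A [[sq pq] [sr ps]]]|none] :=
    pselect ((primsolves k q `&` primsolves l r : set T) !=set0); last first.
  by rewrite (_ : _ `&` _ = set0) ?/pr ?set0I ?measure0 //;
    apply/seteqP; split=> // A ?; apply: none; exists A.
have row0 q' : ev (row 0 A) q' 0 0 = ev A q' 0 0.
  by rewrite !evE; apply: eq_bigr => j _; rewrite mxE.
have onto := dichotomy mq mr qr.
have {}onto v w : exists x : 'rV[laurent F]_n.+1,
    matches k (ev x q 0 0) v /\ matches l (ev x r 0 0) w.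
  by apply: (onto k l (row 0 A)); rewrite row0.
have := measure_allsmall2 haar muM onto; rewrite natrM !natrX invfM mulrA => prE2.
rewrite -lee_fin -prE2 -prE; last first.
  by apply: measurableI; exact: measurable_primsolves.
apply: le_measure; rewrite ?inE //.
- by apply: measurableI; [apply: measurableI; exact: measurable_primsolves|
    exact: measurable_cell].
- apply: measurableI; last exact: measurable_cell.
  rewrite (_ : [set A | _ /\ _] = solves k q `&` solves l r) //.
  by apply: measurableI; exact: measurable_solves.
- by apply: setSI => B [[? _] [? _]].
Qed.

(** There are s test polynomials of degree 1 and at most (s - 1) s^(e-1) of degree
    e > 1. The worst case n = 0 is bounded by
    1/s + (1 - 1/s) (s^-2 + s^-3 + ...) = 1/s + 1/s^2, at most 3/4. *)
Lemma sum_test t : \sum_(d <- testpolys F t)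
    (s ^- (size d).-1 * s ^- (n.+1 * (size d).-1)) <= 3 / 4.
Proof.
pose g e : R := if e == 0%N then s^-1 else (1 - s^-1) * s ^- e.+1.
have gE (e : nat) : \sum_(w : 'rV[F]_e.+1 | testable w)
    (s ^- (size (testpoly w)).-1 * s ^- (n.+1 * (size (testpoly w)).-1)) <= g e.
  under eq_bigr do rewrite size_testpoly /=.
  rewrite sumr_const -[leLHS]mulr_natl.
  have se : s ^- (n.+1 * e.+1) <= s ^- e.+1.
    rewrite lef_pV2 ?posrE ?exprn_gt0 // ler_eXn2l; last by apply: lt_le_trans s2; rewrite ltr1n.
    by rewrite mulSn leq_addr.
  have cardt : #|@testable F e|%:R <= g e * (s ^+ e.+1 * s ^+ e.+1).
    have := card_testable F e; rewrite -(ler_nat R) => /le_trans; apply.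
    rewrite /g; case: eqP => [->|_].
      by rewrite mul0n subn0 expn1 expr1 mulKf // gt_eqF.
    rewrite mul1n natrB ?leq_exp2l ?card_finNzRing_gt1 // !natrX.
    have key (a x : R) : a != 0 -> x != 0 ->
        a * x - x = (1 - a^-1) * (a * x)^-1 * (a * x * (a * x)).
      by move=> a0 x0; field; rewrite a0 x0.
    by rewrite exprS -key ?expf_neq0 // gt_eqF.
  apply: (@le_trans _ _ (#|@testable F e|%:R * (s ^- e.+1 * s ^- e.+1))).
    apply: ler_wpM2l; first exact: ler0n.
    by apply: ler_wpM2l => //; rewrite invr_ge0 exprn_ge0 // ltW.
  by rewrite -invfM ler_pdivrMr // mulr_gt0 ?exprn_gt0.
have gsum t' : \sum_(e < t'.+1) g e = s^-1 + s ^- 2 - s ^- t'.+2.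
  elim: t' => [|t' IH]; first by rewrite big_ord1 /g /= addrK.
  rewrite big_ord_recr /= IH /g /=.
  rewrite (_ : s ^- t'.+3 = s^-1 * s ^- t'.+2); last by rewrite [in LHS]exprS invfM.
  move: (s ^- t'.+2) => x; ring.
rewrite big_testpolys; apply: (@le_trans _ _ (\sum_(e < t) g e)).
  by apply: ler_sum => e _; exact: gE.
case: t => [|t]; first by rewrite big_ord0 divr_ge0.
rewrite gsum; apply: (@le_trans _ _ (s^-1 + s ^- 2)).
  by rewrite gerBl invr_ge0 exprn_ge0 // ltW.
have s1 : s^-1 <= 2^-1 by rewrite lef_pV2 ?posrE.
have : s ^- 2 <= 2^-1 ^+ 2 by rewrite -exprVn lerXn2r ?nnegrE ?invr_ge0 // ltW.
lra.
Qed.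

Lemma size_test t d : d \in testpolys F t ->
  exists2 e, size d = e.+1 & (e <= t)%N.
Proof.
move=> /flatten_mapP[e]; rewrite mem_iota add0n => /= et /mapP[w _ ->].
by exists e.+1; rewrite ?size_testpoly.
Qed.

(** A solution that is not primitive is detected by a test polynomial d, which
    divides q for at most s^((n+1)(t - deg d)) of the vectors q, and then divides
    the polynomial part with conditional probability s^(- deg d). By [sum_test]
    this loses at most three quarters of the total. *)
Lemma first_moment t k : s ^+ (n.+1 * t) * (M / s ^+ (m.+1 * k)) / 4 <=
  \sum_(c : 'M[F]_(n.+1, t)) pr (primsolves k (fam c)).
Proof.
pose w := M / s ^+ (m.+1 * k).
have w0 : 0 <= w by rewrite divr_ge0 ?exprn_ge0 // ltW.
have split (c : 'M[F]_(n.+1, t)) : w <= pr (primsolves k (fam c)) +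
    \sum_(d <- testpolys F t | fdvd d (fam c)) w / s ^+ (size d).-1.
  (* None stands for the primitive solutions, Some d for those with p divisible by d. *)
  pose E (o : option {poly F}) : set T := if o is Some d then dvdsolves k (fam c) d
    else primsolves k (fam c).
  have mE o : measurable (E o) by case: o => [d|];
    [exact: measurable_dvdsolves|exact: measurable_primsolves].
  pose ds := [seq d <- testpolys F t | fdvd d (fam c)].
  have := @measure_cover _ _ _ mu (cell 0) (@measurable_cell _ _ _ 0) _
    (None :: map Some ds) E mE _ (measurable_solves k (fam c)).
  under eq_bigr do rewrite prE //.
  rewrite prE; last exact: measurable_solves.
  rewrite sumEFin lee_fin pr_solves ?fam_neq0 // big_cons big_map => H.
  apply: le_trans (H _) _.
    move=> A A0 Ac.
    have [pA|/nonprimitive_test[d dt /andP[XA dc]]] :=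
      pselect (primitive (lpol (ev A (fam c) 0 0)) (fam c)).
      by exists None => //; rewrite inE.
    exists (Some d) => //; rewrite inE /=; apply: map_f.
    by rewrite mem_filter dc.
  rewrite lerD2l big_filter big_seq_cond [leRHS]big_seq_cond.
  apply: ler_sum => d /andP[/size_test[e sd _] dc].
  by rewrite /= (pr_dvdsolves _ _ sd) ?fam_neq0 // sd.
have : \sum_(c : 'M[F]_(n.+1, t)) w <= \sum_(c : 'M[F]_(n.+1, t))
    (pr (primsolves k (fam c)) +
     \sum_(d <- testpolys F t | fdvd d (fam c)) w / s ^+ (size d).-1).
  by apply: ler_sum => c _; exact: split.
rewrite sumr_const card_mx -[_ *+ (_ ^ _)]mulr_natl natrX big_split /= => /le_trans.
rewrite -/w => H.
(* What is not lost to imprimitive solutions is at least one quarter. *)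
have aux (x y : R) : x <= y + 3 / 4 * x -> x / 4 <= y by lra.
apply: aux; apply: H; rewrite lerD2l.
under eq_bigr do rewrite big_mkcond.
rewrite exchange_big /=.
apply: (@le_trans _ _ (\sum_(d <- testpolys F t)
   (s ^- (size d).-1 * s ^- (n.+1 * (size d).-1)) * (s ^+ (n.+1 * t) * w))).
  rewrite big_seq [leRHS]big_seq; apply: ler_sum => d /size_test[e sd et].
  rewrite -big_mkcond sumr_const -[leLHS]mulr_natl sd -pred_Sn.
  have cd := card_fam_dvd n sd et.
  rewrite [#|_|](_ : _ = #|[pred c : 'M[F]_(n.+1, t) | fdvd d (fam c)]|);
    last exact: eq_card.
  set C := (#|_|%:R : R).
  have CE : C <= s ^- (n.+1 * e) * s ^+ (n.+1 * t).
    rewrite mulrC ler_pdivlMr ?exprn_gt0 // -!natrX -natrM ler_nat.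
    rewrite (leq_trans (leq_mul cd (leqnn _))) //.
    by rewrite -expnD -mulnDr subnK.
  rewrite [leRHS](_ : _ = (s ^- (n.+1 * e) * s ^+ (n.+1 * t)) * (w / s ^+ e)).
    by apply: ler_wpM2r => //; rewrite divr_ge0 // exprn_ge0 // ltW.
  by ring.
by rewrite -mulr_suml ler_wpM2r ?sum_test // mulr_ge0 // exprn_ge0 // ltW.
Qed.

End Moments.

Section Divergence.
Variables (R : realType) (F : finFieldType) (m n : nat).
Local Notation mx := 'M[laurent F]_(m.+1, n.+1).
Local Notation T := (borel_mx F m.+1 n.+1).
Variables (mu : {measure set T -> \bar R}).
Hypotheses (haar : haar_measure mu).
Implicit Types (q r : 'cV[{poly F}]_n.+1).

Local Notation s := (#|F|%:R : R).

Let s2 : 2 <= s.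
Proof. by rewrite ler_nat card_finNzRing_gt1. Qed.

Let s0 : 0 < s. Proof. by apply: lt_le_trans s2. Qed.

(** Let S be the expected number of solutions, normalized by M. The number Z of
    primitive solutions has first moment at least M S / 4, and second moment at
    most M (S^2 + S) by [pr_primsolves2]. Taking lam = 1 / (8 S) in
    [second_moment] leaves M / 16 - M / 32. The bound does not depend on
    kappa; this uniformity is what [tailset_full] needs. *)
Lemma measure_union_lower M (kappa : nat -> nat) u v (A : set T) :
  0 < M -> mu (cell 0) = M%:E -> measurable A ->
  (forall t (c : 'M[F]_(n.+1, t)), (u <= t)%N ->
     primsolves (kappa t) (fam c) `<=` A) ->
  1 <= \sum_(t < v) s ^+ (n.+1 * (u + t)) / s ^+ (m.+1 * kappa (u + t)%N) ->
  M / 32 <= pr mu A.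
Proof.
move=> M0 muM mA sub; set S := \sum_(t < v) _ => S1.
pose J := {t : 'I_v & 'M[F]_(n.+1, u + t)}.
pose k (x : J) := kappa (u + tag x)%N.
pose E (x : J) : set T := primsolves (k x) (fam (tagged x)).
pose w (x : J) : R := s ^- (m.+1 * k x).
have w0 x : 0 <= w x by rewrite invr_ge0 exprn_ge0 // ltW.
have mE x : measurable (E x) by exact: measurable_primsolves.
have sumw : \sum_x w x = S.
  rewrite -(sig_big_dep xpredT (fun=> xpredT)
    (fun (t : 'I_v) (c : 'M[F]_(n.+1, u + t)) => s ^- (m.+1 * kappa (u + t)%N))) /=.
  apply: eq_bigr => t _; rewrite sumr_const card_mx.
  by rewrite -[LHS]mulr_natl natrX.
have sum1 : M * S / 4 <= \sum_x pr mu (E x).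
  rewrite -(sig_big_dep xpredT (fun=> xpredT)
    (fun (t : 'I_v) (c : 'M[F]_(n.+1, u + t)) =>
       pr mu (primsolves (kappa (u + t)%N) (fam c)))) /=.
  rewrite mulr_sumr mulr_suml; apply: ler_sum => t _.
  apply: le_trans (first_moment haar M0 muM _ _).
  by rewrite !mulrA (mulrC M).
have inj (x y : J) : x != y -> fam (tagged x) != fam (tagged y).
  apply: contraNneq; case: x y => [t c] [t' c'] /= ff.
  have tt' : t = t'.
    apply/val_inj/(@addnI u)/succn_inj; rewrite -(fam_size0 c) -(fam_size0 c').
    by rewrite ff.
  by case: t' / tt' c' ff => c' /fam_inj ->.
have pair x y : pr mu (E x `&` E y) <= M * (w x * w y) + (x == y)%:R * (M * w x).
  have [<-|xy] := eqVneq x y.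
    rewrite setIid mul1r; apply: (@le_trans _ _ (M * w x)).
      rewrite -(pr_solves haar muM (k x) (fam_neq0 (tagged x))).
      apply: (pr_le muM) => //; first exact: measurable_solves.
      by move=> B [].
    by rewrite lerDr mulr_ge0 ?mulr_ge0 // ltW.
  rewrite mul0r addr0 mulrA.
  by apply: (pr_primsolves2 haar M0 muM); rewrite ?fam_monic // inj.
have sum2 : \sum_x \sum_y pr mu (E x `&` E y) <= M * (S ^+ 2 + S).
  apply: (@le_trans _ _ (\sum_x \sum_y
      (M * (w x * w y) + (x == y)%:R * (M * w x)))).
    by apply: ler_sum => x _; apply: ler_sum => y _; exact: pair.
  rewrite mulrDr expr2 -sumw mulr_suml !mulr_sumr -big_split /=.
  apply: ler_sum => x _; rewrite big_split /= -!mulr_sumr lerD2l.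
  rewrite (bigD1 x) //= big1 ?eqxx ?addr0 ?mul1r //.
  by move=> y yx; rewrite eq_sym (negPf yx) mul0r.
have lam0 : 0 <= (8 * S)^-1 by rewrite invr_ge0 mulr_ge0 // (le_trans _ S1).
have := @second_moment _ _ _ mu (cell 0) (@measurable_cell _ _ _ 0) _ (index_enum J) E mE
   A _ mA lam0.
have -> : (\sum_x mu (E x `&` cell 0) = (\sum_x pr mu (E x))%:E)%E.
  by rewrite -sumEFin; apply: eq_bigr => x _; rewrite (prE muM).
have -> : (\sum_x \sum_y mu (E x `&` E y `&` cell 0) =
    (\sum_x \sum_y pr mu (E x `&` E y))%:E)%E.
  rewrite -sumEFin; apply: eq_bigr => x _; rewrite -sumEFin.
  by apply: eq_bigr => y _; rewrite (prE muM) //; exact: measurableI.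
rewrite (prE muM) // -!EFinM -EFinD lee_fin => H.
have subE x B : x \in index_enum J -> cell 0 B -> E x B -> A B.
  by move=> _ _; apply: sub; exact: leq_addr.
move: sum1 sum2 (H subE); set Y := \sum_x \sum_y _; set X := \sum_x _ => sum1 sum2 {}H.
have S0 : 0 < S by apply: lt_le_trans S1.
have h1 : 2 * (8 * S)^-1 * (M * S / 4) <= 2 * (8 * S)^-1 * X.
  by apply: ler_wpM2l sum1; rewrite mulr_ge0.
have h2 : (8 * S)^-1 ^+ 2 * Y <= (8 * S)^-1 ^+ 2 * (M * (S ^+ 2 + S)).
  by apply: ler_wpM2l sum2; rewrite exprn_ge0.
have e1 : 2 * (8 * S)^-1 * (M * S / 4) = M / 16 by field; rewrite gt_eqF.
have e2 : (8 * S)^-1 ^+ 2 * (M * (S ^+ 2 + S)) = M / 64 * (1 + S^-1).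
  by field; rewrite gt_eqF.
have h3 : M / 64 * (1 + S^-1) <= M / 64 * 2.
  apply: ler_wpM2l; first by rewrite divr_ge0 // ltW.
  by rewrite -[2]/(1 + 1) lerD2l invf_le1.
lra.
Qed.

End Divergence.

(** * Tail sets stable under scaling of the denominator *)

Section Tail.
Variables (F : finFieldType) (m n : nat).
Local Notation mx := 'M[laurent F]_(m, n).
Implicit Types (q : 'cV[{poly F}]_n) (A B : mx).

(** The norm of q is s^t. *)
Definition height q t :=
  (forall i, (size (q i 0)%R <= t.+1)%N) /\ exists i, size (q i 0) = t.+1.

(** The shift by j leaves room for multiplying q by X^j, which raises the height by
    j and can spoil j fractional coefficients of A q. The intersection over j
    is then invariant under translation by all the matrices X^-N P. *)
Definition tailset (kappa : nat -> nat) j : set mx :=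
  [set A | exists t q, [/\ (j <= t)%N, height q t &
     allsmall (kappa (t + j) + j)%N A q]].

Lemma open_tailset kappa j : open (tailset kappa j).
Proof.
apply: open_cell => A [t [q [jt hq Aq]]].
have [N qN] := ev_cell m (kappa (t + j) + j)%N q; exists N => B BN.
exists t, q; split=> // i; rewrite evD_entry; apply: smallD => //.
by apply: small_bnd; exact: qN.
Qed.

Lemma height_Xn q t N : height q t -> height ('X^N *: q) (t + N)%N.
Proof.
have sX i : q i 0 != 0 -> size (('X^N *: q) i 0) = (size (q i 0)%R + N)%N.
  by move=> q0; rewrite mxE mulrC size_mulXn // addnC.
move=> [qt [i qi]]; split=> [j|].
  have [q0|q0] := eqVneq (q j 0) 0; first by rewrite mxE q0 mulr0 size_poly0.
  by rewrite sX // -addSn leq_add2r.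
by exists i; rewrite sX ?qi ?addSn // -size_poly_gt0 qi.
Qed.

(** (A + X^-N P) (X^N q) differs from X^N (A q) by the polynomial vector P q, and
    multiplication by X^N moves N fractional coefficients into the polynomial
    part. *)
Lemma allsmall_Xn k N A (P : 'M[{poly F}]_(m, n)) q :
  allsmall (k + N)%N A q -> allsmall k (A + Xdiv_mx N P) ('X^N *: q).
Proof.
move=> Aq i; rewrite evZ mxE evD_entry mulrDr; apply: smallD.
  exact: small_Xn.
rewrite [X in small k X](_ : _ = lp ((P *m q) i 0)); first by move=> j.
rewrite evE mulr_sumr mxE rmorph_sum; apply: eq_bigr => j _.
by rewrite mulrA Xdiv_mxM rmorphM.
Qed.

Lemma tailset_translate kappa j N A (P : 'M[{poly F}]_(m, n)) :
  tailset kappa (j + N)%N A -> tailset kappa j (A + Xdiv_mx N P).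
Proof.
move=> [t [q [jt hq Aq]]]; exists (t + N)%N, ('X^N *: q); split.
- by rewrite (leq_trans (leq_addr N j)) // (leq_trans jt) // leq_addr.
- exact: height_Xn.
- by apply: allsmall_Xn; rewrite -addnA -[(t + N + j)%N]addnA (addnC N j).
Qed.

Lemma Xdiv_mx0 N : Xdiv_mx N (0 : 'M[{poly F}]_(m, n)) = 0.
Proof. by apply/matrixP => i j; rewrite !mxE raddf0 mul0r. Qed.

Lemma tailset_sub kappa j N : tailset kappa (j + N)%N `<=` tailset kappa j.
Proof. by move=> A /(tailset_translate 0); rewrite Xdiv_mx0 addr0. Qed.

Lemma tailset_infinite kappa A : (\bigcap_j tailset kappa j) A ->
  forall j, exists t q, [/\ (j <= t)%N, height q t & allsmall (kappa t) A q].
Proof.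
move=> TA j; have [t [q [jt hq Aq]]] := TA j Logic.I.
exists (t + j)%N, ('X^j *: q); split; first exact: leq_addl.
  exact: height_Xn.
by rewrite -[A]addr0 -(Xdiv_mx0 j); exact: allsmall_Xn.
Qed.

End Tail.

(** * Cauchy condensation *)

Section Condensation.
Variables (R : realType) (psi : nat -> R) (b : nat).
Hypothesis b2 : (2 <= b)%N.
Hypothesis psi_ge0 : forall k, (0 < k)%N -> 0 <= psi k.
Hypothesis psi_ni : forall j k, (0 < j)%N -> (j <= k)%N -> psi k <= psi j.

Let S (N : nat) : R := \sum_(0 <= j < N) psi j.+1.

Let SD N N' : (N <= N')%N -> S N' = S N + \sum_(N <= j < N') psi j.+1.
Proof. by move=> NN'; rewrite /S (@big_cat_nat _ _ _ N 0%N N') //=. Qed.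

Let S_nd N N' : (N <= N')%N -> S N <= S N'.
Proof.
by move=> NN'; rewrite (SD NN') lerDl; apply: sumr_ge0 => j _; exact: psi_ge0.
Qed.

Let expb_gt0 t : (0 < b ^ t)%N.
Proof. by rewrite expn_gt0 (leq_trans _ b2). Qed.

(** On each block from b^t to b^(t+1) - 1, psi is at most psi (b^t). *)
Lemma condensation_upper v :
  S (b ^ v).-1 <= b%:R * \sum_(t < v) (b ^ t)%:R * psi (b ^ t)%N.
Proof.
elim: v => [|v IH]; first by rewrite /S expn0 big_nil big_ord0 mulr0.
have le : ((b ^ v).-1 <= (b ^ v.+1).-1)%N.
  by rewrite -ltnS !prednK // leq_exp2l.
rewrite (SD le) big_ord_recr mulrDr /=; apply: lerD => //.
apply: (@le_trans _ _ (\sum_((b ^ v).-1 <= j < (b ^ v.+1).-1) psi (b ^ v)%N)).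
  rewrite big_nat_cond [leRHS]big_nat_cond; apply: ler_sum => j.
  rewrite andbT => /andP[bj _]; apply: psi_ni => //.
  by rewrite -(prednK (expb_gt0 v)) ltnS.
rewrite sumr_const_nat -[leLHS]mulr_natl [leRHS]mulrA; apply: ler_wpM2r; first exact: psi_ge0.
by rewrite -natrM ler_nat -expnS (leq_trans (leq_subr _ _)) // leq_pred.
Qed.

(** On each block from b^t + 1 to b^(t+1), psi is at least psi (b^(t+1)), and the
    block contains at least half of its last index. *)
Lemma condensation_lower v :
  \sum_(t < v.+1) (b ^ t)%:R * psi (b ^ t)%N <= psi 1%N + 2 * S (b ^ v).
Proof.
elim: v => [|v IH].
  rewrite big_ord1 expn0 mul1r lerDl mulr_ge0 // /S big_nat1; exact: psi_ge0.
have le : (b ^ v <= b ^ v.+1)%N by rewrite leq_exp2l.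
rewrite big_ord_recr /= (SD le) mulrDr addrA; apply: lerD => //.
apply: (@le_trans _ _
    (2 * \sum_(b ^ v <= j < b ^ v.+1) psi (b ^ v.+1)%N)); last first.
  apply: ler_wpM2l => //; rewrite big_nat_cond [leRHS]big_nat_cond.
  apply: ler_sum => j; rewrite andbT => /andP[_ jb]; exact: psi_ni.
rewrite sumr_const_nat -[X in 2 * X]mulr_natl [leRHS]mulrA; apply: ler_wpM2r; first exact: psi_ge0.
rewrite -natrM ler_nat mulnBr mul2n -addnn -addnBA ?leq_addr //.
by rewrite expnS leq_mul2r b2 orbT.
Qed.

Lemma cvg_series_bounded (C : R) :
  (forall N, S N <= C) -> cvgn (series (fun j => psi j.+1)).
Proof.
move=> SC; apply: nondecreasing_is_cvgn; first by move=> N N'; exact: S_nd.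
by exists C => _ [N _ <-]; exact: SC.
Qed.

Lemma series_bounded : cvgn (series (fun j => psi j.+1)) ->
  exists C, forall N, S N <= C.
Proof.
move=> cv; exists (limn (series (fun j => psi j.+1))) => N.
by apply: nondecreasing_cvgn_le => // k k'; exact: S_nd.
Qed.

Lemma dvg_series_pos : ~ cvgn (series (fun j => psi j.+1)) ->
  forall k, (0 < k)%N -> 0 < psi k.
Proof.
move=> ncv k k0; rewrite lt_neqAle psi_ge0 // andbT eq_sym.
apply/eqP => psik; apply: ncv; apply: (@cvg_series_bounded (S k)) => N.
have [/S_nd //|/ltnW kN] := leqP N k.
rewrite (SD kN) big_nat_cond big1 ?addr0 // => j /andP[/andP[kj _] _].
apply/eqP; rewrite eq_le psi_ge0 // -psik andbT; apply: psi_ni => //.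
exact: leqW.
Qed.

(** In the application a t is the probability that a given vector of height t is a
    solution; it is 1 when psi is large, so only max 1 (psi 1) * a t dominates psi. *)
Lemma dvg_condensed (a : nat -> R) :
  (forall t, 0 <= a t) ->
  (forall t, a t < 1 -> psi (b ^ t)%N <= a t) ->
  ~ cvgn (series (fun j => psi j.+1)) ->
  forall C, exists v, C <= \sum_(t < v) (b ^ t)%:R * a t.
Proof.
move=> a0 psia ncv C; apply: contrapT => /forallNP nC; apply: ncv.
(* Where a t >= 1, psi is still at most psi 1. *)
pose K := Num.max 1 (psi 1%N).
have K1 : 1 <= K by rewrite le_max lexx.
have psiK t : psi (b ^ t)%N <= K * a t.
  have [/psia psit|a1] := ltP (a t) 1.
    by rewrite (le_trans psit) // ler_peMl.
  apply: (@le_trans _ _ (psi 1%N)); first exact: psi_ni.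
  apply: (@le_trans _ _ K); first by rewrite le_max lexx orbT.
  by rewrite ler_peMr // (le_trans _ K1).
apply: (@cvg_series_bounded (b%:R * (K * C))) => N.
apply: (@le_trans _ _ (S (b ^ N).-1)).
  by apply: S_nd; rewrite -ltnS prednK // ltn_expl.
apply: le_trans (condensation_upper N) _; apply: ler_wpM2l => //.
apply: (@le_trans _ _ (K * \sum_(t < N) (b ^ t)%:R * a t)).
  rewrite mulr_sumr; apply: ler_sum => t _; rewrite mulrCA.
  by apply: ler_wpM2l => //; exact: psiK.
apply: ler_wpM2l; first by apply: le_trans K1.
by apply: ltW; rewrite ltNge; apply/negP; exact: nC.
Qed.

Lemma cvg_condensed : cvgn (series (fun j => psi j.+1)) ->
  exists C, forall v, \sum_(t < v) (b ^ t)%:R * psi (b ^ t)%N <= C.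
Proof.
move=> /series_bounded[C SC]; exists (psi 1%N + 2 * C) => v.
apply: (@le_trans _ _ (\sum_(t < v.+1) (b ^ t)%:R * psi (b ^ t)%N)).
  by rewrite big_ord_recr /= lerDl mulr_ge0 // psi_ge0.
apply: le_trans (condensation_lower v) _; rewrite lerD2l.
by apply: ler_wpM2l.
Qed.

End Condensation.

(** * Almost all and almost no matrices *)

Section LimsupMeasure.
Variables (R : realType) (F : finFieldType).

Let s2 : 2 <= #|F|%:R :> R.
Proof. by rewrite ler_nat card_finNzRing_gt1. Qed.

Let s0 : 0 < #|F|%:R :> R. Proof. by apply: lt_le_trans s2. Qed.

(** Each tail set meets the unit ball in measure at least M / 32, by
    [measure_union_lower] applied to the shifted levels; as the tail
    sets decrease, the same holds for their intersection, to which [zero_one]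
    applies. *)
Theorem tailset_full m n (mu : {measure set (borel_mx F m.+1 n.+1) -> \bar R})
    (kappa : nat -> nat) :
  haar_measure mu ->
  (forall C : R, exists v, C <= \sum_(t < v)
     #|F|%:R ^+ (n.+1 * t) / #|F|%:R ^+ (m.+1 * kappa t)) ->
  mu (~` \bigcap_j tailset kappa j) = 0%E.
Proof.
move=> haar div; have [M M0 muM] := haar_cell0 haar.
have mA j : measurable (tailset kappa j : set (borel_mx F m.+1 n.+1)).
  by apply: open_measurable_mx; exact: open_tailset.
have m0 := @measurable_cell F m.+1 n.+1 0.
have low j : M / 32 <= pr mu (tailset kappa j).
  pose a i : R := #|F|%:R ^+ (n.+1 * i) / #|F|%:R ^+ (m.+1 * kappa i).
  have a0 i : 0 <= a i by rewrite divr_ge0 ?exprn_ge0 // ltW.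
  pose c : R := #|F|%:R ^+ (n.+1 * j) * #|F|%:R ^+ (m.+1 * j).
  have c0 : 0 < c by rewrite mulr_gt0 ?exprn_gt0.
  (* The two shifts by j, in the height and in the index of kappa, skip 2 j terms. *)
  have [v Hv] := div (c + \sum_(i < j + j) a i).
  apply: (@measure_union_lower _ _ _ _ _ haar M
    (fun t => (kappa (t + j) + j)%N) j v) => //.
    move=> t f jt A [Af _]; exists t, (fam f); split => //; split.
      by move=> i; exact: fam_size.
    by exists 0; exact: fam_size0.
  have -> : \sum_(t < v) #|F|%:R ^+ (n.+1 * (j + t)) /
      #|F|%:R ^+ (m.+1 * (kappa (j + t + j)%N + j)) =
      c^-1 * \sum_(t < v) a (j + j + t)%N.
    rewrite mulr_sumr; apply: eq_bigr => t _; rewrite /a /c.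
    rewrite [(j + t + j)%N]addnAC !mulnDr !exprD.
    have e0 k : #|F|%:R ^+ k != 0 :> R by rewrite expf_neq0 // gt_eqF.
    by field; rewrite !e0.
  rewrite mulrC ler_pdivlMr // mul1r -(lerD2r (\sum_(i < j + j) a i)).
  apply: le_trans Hv _; rewrite [leRHS](_ : _ = \sum_(i < j + j + v) a i).
    rewrite -!(big_mkord xpredT a) addnC.
    by rewrite (@big_cat_nat _ _ _ v 0%N (v + (j + j))) ?leq_addr //= lerDl sumr_ge0.
  by rewrite [RHS]big_split_ord addrC.
have mT : measurable (\bigcap_j tailset kappa j : set (borel_mx F m.+1 n.+1)).
  exact: bigcapT_measurable.
apply: (zero_one haar mT).
  move=> A B [N [P ->]] TA j _; apply: tailset_translate; exact: TA.
pose G j : set (borel_mx F m.+1 n.+1) := tailset kappa j `&` cell 0.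
have GE : (\bigcap_j tailset kappa j) `&` cell 0 = \bigcap_j G j.
  apply/seteqP; split=> [A [TA A0] j _|A GA]; first by split => //; exact: TA.
  by split=> [j _|]; [have [] := GA j Logic.I|have [] := GA 0%N Logic.I].
have mG j : measurable (G j) by exact: measurableI.
have cvG : mu (G j) @[j --> \oo] --> mu (\bigcap_j G j).
  apply: nonincreasing_cvg_mu => //; first 1 last.
  - exact: bigcapT_measurable.
  - move=> i j ij; rewrite subsetEset; apply: setSI.
    by rewrite -(subnKC ij); exact: tailset_sub.
  by rewrite /G (prE muM) // ltry.
rewrite GE; apply: (@lt_le_trans _ _ (M / 32)%:E); first by rewrite lte_fin divr_gt0.
apply: cvge_ge cvG; apply: nearW => j.
by rewrite /G (prE muM) // lee_fin.
Qed.

(** Borel-Cantelli on each translate of the unit ball: there are at most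
    s^(n (t+1)) vectors of height t, each solved with probability
    s^(- m kappa t), and the events are invariant under polynomial translations. *)
Theorem solutions_null m n (mu : {measure set (borel_mx F m n) -> \bar R})
    (good : nat -> bool) (kappa : nat -> nat) (C : R) :
  haar_measure mu ->
  (forall v, \sum_(t < v | good t)
     #|F|%:R ^+ (n * t) / #|F|%:R ^+ (m * kappa t) <= C) ->
  mu.-negligible [set A | forall j, exists t q,
    [/\ (j <= t)%N, good t, q != 0, height q t & allsmall (kappa t) A q]].
Proof.
move=> haar sumC; have [M M0 muM] := haar_cell0 haar.
have m0 := @measurable_cell F m n 0.
pose H t : set (borel_mx F m n) := [set A | good t /\
   exists q, [/\ q != 0, height q t & allsmall (kappa t) A q]].
have mH t : measurable (H t).
  apply: open_measurable_mx; apply: open_cell => A [gt [q [q0 hq Aq]]].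
  have [N qN] := ev_cell m (kappa t) q; exists N => B BN; split=> //.
  exists q; split=> // i; rewrite evD_entry; apply: smallD => //.
  by apply: small_bnd; exact: qN.
pose a t : R := if good t then
  #|F|%:R ^+ (n * t.+1) * (M / #|F|%:R ^+ (m * kappa t)) else 0.
have muH t : (mu (H t `&` cell 0) <= (a t)%:E)%E.
  rewrite /a; case: ifPn => [gt|/negP ngt]; last first.
    rewrite (_ : H t = set0) ?set0I ?measure0 //.
    by apply/seteqP; split=> // A [].
  pose qc (c : 'M[F]_(n, t.+1)) : 'cV[{poly F}]_n := \col_j rVpoly (row j c).
  pose E c : set (borel_mx F m n) := [set A | qc c != 0 /\ allsmall (kappa t) A (qc c)].
  have mE c : measurable (E c).
    apply: open_measurable_mx; apply: open_cell => A [q0 Aq].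
    have [N qN] := ev_cell m (kappa t) (qc c); exists N => B BN; split=> // i.
    rewrite evD_entry; apply: smallD => //; apply: small_bnd; exact: qN.
  have := @measure_cover _ _ _ mu (cell 0) m0 _ (index_enum _) E mE _ (mH t).
  move=> /(_ _)/le_trans; apply.
    move=> A A0 [_ [q [q0 [qt _] Aq]]].
    pose c : 'M[F]_(n, t.+1) := \matrix_j poly_rV (q j 0).
    have qcE : qc c = q.
      by apply/matrixP => j i; rewrite ord1 mxE rowK poly_rV_K.
    by exists c; rewrite ?mem_index_enum // /E /= qcE.
  apply: (@le_trans _ _ (\sum_(c : 'M[F]_(n, t.+1))
      (M / #|F|%:R ^+ (m * kappa t))%:E)%E).
    apply: lee_sum => c _; have [q0|q0] := eqVneq (qc c) 0.
      rewrite (_ : E c = set0) ?set0I ?measure0 ?lee_fin.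
        by rewrite divr_ge0 ?exprn_ge0 // ltW.
      by apply/seteqP; split=> // A []; rewrite q0 eqxx.
    rewrite (_ : E c = [set A | allsmall (kappa t) A (qc c)]).
      by rewrite (measure_allsmall haar muM) // natrX.
    by apply/seteqP; split=> A // [].
  rewrite sumEFin sumr_const card_mx lee_fin.
  by rewrite -[leLHS]mulr_natl natrX.
apply: negligible_cosets => P.
pose G t : set (borel_mx F m n) := H t `&` coset (Xdiv_mx 0 P) 0.
have mG t : measurable (G t).
  by apply: measurableI => //; apply: open_measurable_mx; exact: open_coset.
have muG t : mu (G t) = mu (H t `&` cell 0).
  rewrite -[RHS](@haar_invariant _ _ _ _ _ haar (Xdiv_mx 0 P)); last exact: measurableI.
  congr (mu _); rewrite mxshiftE; apply/seteqP; split=> A [[gt [q [q0 hq Aq]]] AP];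
      split=> //=; split=> //; exists q; split=> // i.
    rewrite -Xdiv_mxN evD_entry; apply: smallD; first exact: Aq.
    by rewrite ev_poly_mx.
  rewrite -[A](subrK (Xdiv_mx 0 P)) evD_entry; apply: smallD; first exact: Aq.
  by rewrite ev_poly_mx.
have null : mu (lim_sup_set G) = 0%E.
  apply: lim_sup_set_cvg0 => //.
  apply: (@le_lt_trans _ _ (#|F|%:R ^+ n * M * C)%:E); last by rewrite ltry.
  apply: lime_le; first by apply: is_cvg_nneseries => t _ _.
  apply: nearW => v; apply: (@le_trans _ _ (\sum_(0 <= t < v) (a t)%:E)%E).
    by apply: lee_sum => t _; rewrite muG; exact: muH.
  rewrite sumEFin lee_fin big_mkord /a -big_mkcond /=.
  apply: (@le_trans _ _ (#|F|%:R ^+ n * M *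
     \sum_(t < v | good t) #|F|%:R ^+ (n * t) / #|F|%:R ^+ (m * kappa t))).
    rewrite mulr_sumr; apply: ler_sum => t _; rewrite mulnS exprD.
    by rewrite !mulrA ler_wpM2r ?invr_ge0 ?exprn_ge0 ?(ltW s0) // -!mulrA [M * _]mulrC.
  by apply: ler_wpM2l => //; rewrite mulr_ge0 ?exprn_ge0 // ltW.
apply: (@negligibleS _ _ _ _ (lim_sup_set G)); last first.
  apply/negligibleP => //; apply: bigcapT_measurable => j.
  by apply: bigcup_measurable.
move=> A [WA AP] j _; have [t [q [jt gt q0 hq Aq]]] := WA j.
by exists t => //; split=> //; split=> //; exists q.
Qed.

End LimsupMeasure.

(** * From the inequality to vanishing coefficients *)

Section Approximation.
Variables (R : realType) (F : finFieldType).
Local Notation s := (#|F|%:R : R).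

Let s1 : 1 < s.
Proof. by rewrite ltr1n card_finNzRing_gt1. Qed.

Let s0 : 0 < s. Proof. exact: lt_trans s1. Qed.

Lemma supnorm_ge0 r (v : 'cV[laurent F]_r) : 0 <= supnorm v :> R.
Proof.
by apply: (big_ind (fun x : R => 0 <= x)) => // [x y x0 y0|i _];
  [rewrite le_max x0|exact: lnorm_ge0].
Qed.

Lemma supnorm_le r (v : 'cV[laurent F]_r) (N : int) :
  supnorm v <= s ^ N <-> forall i, bnd N (v i 0).
Proof.
split=> [vN i|vN].
  by apply/(lnorm_le R); apply: le_trans vN; apply: le_bigmax.
apply: bigmax_le => [|i _]; first exact: exprz_ge0 (ltW s0).
exact/lnorm_le.
Qed.

Lemma supnorm_height n (q : 'cV[{poly F}]_n) t : height q t ->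
  supnorm (map_mx (@laurent_of_poly F) q) = (#|F| ^ t)%:R :> R.
Proof.
move=> [qt [i qi]]; apply/eqP; rewrite eq_le; apply/andP; split.
  rewrite natrX; apply/(supnorm_le _ t%:Z) => j; rewrite mxE.
  by apply: bnd_lp; rewrite -PoszD addn1 lez_nat.
have q0 : q i 0 != 0 by rewrite -size_poly_gt0 qi.
by rewrite -[t]/(t.+1.-1) -qi -lnorm_poly //; apply: (le_trans _ (le_bigmax _ _ i));
  rewrite mxE.
Qed.

Lemma truncn_height n (q : 'cV[{poly F}]_n) t : height q t ->
  Num.truncn (supnorm (map_mx (@laurent_of_poly F) q) ^+ n : R) =
  ((#|F| ^ n) ^ t)%N.
Proof. by move=> /supnorm_height ->; rewrite -natrX natrK expnAC. Qed.

Lemma exists_height n (q : 'cV[{poly F}]_n) : q != 0 -> exists t, height q t.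
Proof.
move=> q0; have [j qj] := cV_neq0 q0.
case: n q q0 j qj => [|n] q q0 j qj; first by case: j qj.
have In0 : (0 < #|'I_n.+1|)%N by rewrite card_ord.
have [i iM] := bigop.eq_bigmax (fun i => size (q i 0)%R) In0.
have le k : (size (q k 0)%R <= size (q i 0)%R)%N.
  by rewrite -iM; exact: (leq_bigmax k).
have i0 : (0 < size (q i 0)%R)%N.
  by apply: leq_trans (le j); rewrite size_poly_gt0.
by exists (size (q i 0)).-1; split=> [k|]; [|exists i]; rewrite prednK.
Qed.

Lemma finite_height n j : finite_set [set q : 'cV[{poly F}]_n |
  forall i, (size (q i 0)%R <= j)%N].
Proof.
pose f (c : 'M[F]_(n, j)) : 'cV[{poly F}]_n := \col_i rVpoly (row i c).
apply: (sub_finite_set (B := range f)); last exact: finite_image.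
move=> q qj; exists (\matrix_i poly_rV (q i 0)) => //.
by apply/matrixP => i k; rewrite ord1 mxE rowK poly_rV_K.
Qed.

(** There are finitely many vectors of each height. *)
Lemma infinite_height n (P : set 'cV[{poly F}]_n) : infinite_set P <->
  forall j, exists t q, [/\ (j <= t)%N, q != 0, height q t & P q].
Proof.
split=> [Pinf j|Ph Pfin].
  apply: contrapT => none; apply: Pinf.
  apply: sub_finite_set (finite_height n j) => q Pq i.
  have [->|q0] := eqVneq q 0; first by rewrite mxE size_poly0.
  have [t ht] := exists_height q0; have [+ _] := ht.
  move=> /(_ i)/leq_trans; apply; rewrite ltnNge; apply/negP => jt.
  by apply: none; exists t, q.
have /finite_seqP[l Pl] := Pfin.
pose B := (\max_(q <- l) \max_i size (q i ord0))%N.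
have [t [q [Bt _ [_ [i qi]] Pq]]] := Ph B.
have : (size (q i 0)%R <= B)%N.
  have ql : q \in l by move: Pq; rewrite Pl.
  by apply: leq_trans (leq_bigmax_seq _ ql isT); exact: (leq_bigmax i).
by rewrite qi ltnNge Bt.
Qed.

(** s^(-k-1) is the largest norm below 1 whose m-th power is below x. *)
Definition level m (x : R) k :=
  s ^- (m * k.+1) < x /\ ((0 < k)%N -> x <= s ^- (m * k)).

Lemma level_exists m x : (0 < m)%N -> 0 < x -> exists k, level m x k.
Proof.
move=> m0 x0; have ex : exists k, s ^- (m * k.+1) < x.
  exists (Num.bound x^-1).
  rewrite -[ltRHS]invrK ltf_pV2 ?posrE ?exprn_gt0 ?invr_gt0 //.
  have /archi_boundP : 0 <= x^-1 by rewrite invr_ge0 ltW.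
  move/lt_le_trans; apply; rewrite -natrX ler_nat ltnW //.
  apply: leq_trans (ltn_expl _ (card_finNzRing_gt1 F)) _.
  rewrite leq_exp2l ?card_finNzRing_gt1 // (leq_trans (leqnSn _)) //.
  by rewrite leq_pmull.
case: (ex_minnP ex) => k kx kmin; exists k; split=> // k0.
rewrite leNgt; apply/negP => h; have := kmin k.-1; rewrite prednK // => /(_ h).
by rewrite leqNgt prednK // leqnn.
Qed.

(** The best p is the opposite of the polynomial part of A q. *)
Lemma levelP m n (A : 'M[laurent F]_(m, n)) q x k : (0 < m)%N -> level m x k ->
  (exists p : 'cV[{poly F}]_m,
     supnorm (A *m map_mx (@laurent_of_poly F) q +
              map_mx (@laurent_of_poly F) p) ^+ m < x) <->
  allsmall k A q.
Proof.
have entryE i (p : 'cV[{poly F}]_m) : (A *m map_mx (@laurent_of_poly F) q +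
    map_mx (@laurent_of_poly F) p) i 0 = ev A q i 0 + lp (p i 0).
  by rewrite mxE [X in _ + X]mxE.
move=> m0 [kx xk]; split=> [[p] | Aq]; last first.
  pose p : 'cV[{poly F}]_m := \col_i - lpol (ev A q i 0).
  have pE i : p i 0 = - lpol (ev A q i 0) by rewrite mxE.
  exists p.
  apply: le_lt_trans kx; rewrite mulnC exprM -exprVn.
  rewrite lerXn2r ?nnegrE ?invr_ge0 ?exprn_ge0 ?(ltW s0) //.
    exact: supnorm_ge0.
  apply/(supnorm_le _ (Negz k)) => i.
  by rewrite entryE pE rmorphN; exact/small_frac/Aq.
case: k kx xk => [|k] kx xk; first by move=> _ i j.
move=> /lt_le_trans/(_ (xk isT)); rewrite mulnC exprM -exprVn.
rewrite ltr_pXn2r ?nnegrE ?supnorm_ge0 ?invr_ge0 ?exprn_ge0 ?(ltW s0) //.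
set v := (A *m map_mx (@laurent_of_poly F) q + map_mx (@laurent_of_poly F) p).
move=> vk i.
have vb : bnd (Negz k.+1) (v i 0).
  have [->|v0] := eqVneq (v i 0) 0; first by [].
  have dv := ldegP v0; have [_] := dv; apply: bndW.
  have : lnorm (v i 0) < s ^ Negz k.
    by apply: le_lt_trans vk; apply: le_bigmax.
  rewrite (lnormE _ dv) ltr_eXz2l //; lia.
have -> : ev A q i 0 = v i 0 + lp (- p i 0).
  by rewrite entryE rmorphN addrK.
by apply: smallD => //; exact: small_bnd.
Qed.

End Approximation.

Lemma psi_approximableP (R : realType) (F : finFieldType) (m n : nat)
    (psi : nat -> R) (A : 'M[laurent F]_(m, n)) :
  psi_approximable m n psi A <-> forall j, exists t q,
    [/\ (j <= t)%N, q != 0, height q t & exists p : 'cV[{poly F}]_m,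
     supnorm (A *m map_mx (@laurent_of_poly F) q +
              map_mx (@laurent_of_poly F) p) ^+ m < psi ((#|F| ^ n) ^ t)%N].
Proof.
apply: (iff_trans (infinite_height _)); split=> H j;
  have [t [q [jt q0 hq [p]]]] := H j; exists t, q; split=> //; exists p.
  by rewrite -(truncn_height R hq).
by rewrite (truncn_height R hq).
Qed.

Unset Implicit Arguments.

Theorem mainTheorem4 (R : realType) (F : finFieldType) (m n : nat)
    (psi : nat -> R) (mu : {measure set (borel_mx F m n) -> \bar R}) :
  (0 < m)%N -> (0 < n)%N ->
  (forall k : nat, (0 < k)%N -> 0 <= psi k) ->
  (forall j k : nat, (0 < j)%N -> (j <= k)%N -> psi k <= psi j) ->
  haar_measure mu ->
  (~ cvgn (series (fun j : nat => psi j.+1)) ->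
     {ae mu, forall A, psi_approximable m n psi A}) /\
  (cvgn (series (fun j : nat => psi j.+1)) ->
     {ae mu, forall A, ~ psi_approximable m n psi A}).
Proof.
case: m mu => [//|m] mu _; case: n mu => [//|n] mu _ psi0 psini haar.
have b2 : (2 <= #|F| ^ n.+1)%N.
  by rewrite (leq_trans (card_finNzRing_gt1 F)) // -[leqLHS]expn1 leq_exp2l ?card_finNzRing_gt1.
have s0 : 0 < #|F|%:R :> R by rewrite ltr0n (ltnW (card_finNzRing_gt1 F)).
have bE t : ((#|F| ^ n.+1) ^ t)%:R = #|F|%:R ^+ (n.+1 * t) :> R.
  by rewrite -expnM natrX.
split=> [ncv|cv].
  have pos t : 0 < psi ((#|F| ^ n.+1) ^ t)%N.
    by apply: dvg_series_pos => //; rewrite expn_gt0 (ltnW b2).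
  have [kappa kP] := choice (fun t => level_exists F (ltn0Sn m) (pos t)).
  have div (C : R) : exists v, C <= \sum_(t < v)
      #|F|%:R ^+ (n.+1 * t) / #|F|%:R ^+ (m.+1 * kappa t).
    have [t||v Cv] := @dvg_condensed _ psi _ b2 psi0 psini
      (fun t => #|F|%:R ^- (m.+1 * kappa t)) _ _ ncv C.
    - by rewrite invr_ge0 exprn_ge0 // ltW.
    - move=> t a1; have [_] := kP t; apply.
      by rewrite lt0n; apply: contraTneq a1 => ->; rewrite muln0 expr0 invr1 ltxx.
    by exists v; under eq_bigr do rewrite -bE.
  have mT : measurable (\bigcap_j tailset kappa j : set (borel_mx F m.+1 n.+1)).
    by apply: bigcapT_measurable => j; apply: open_measurable_mx; exact: open_tailset.
  exists (~` \bigcap_j tailset kappa j); split.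
  - exact: measurableC.
  - exact: tailset_full haar div.
  apply: subsetC => A TA; apply/psi_approximableP => j.
  have [t [q [jt hq Aq]]] := tailset_infinite TA j.
  exists t, q; split=> //; last exact/(levelP _ _ _ (kP t)).
  by have [_ [i qi]] := hq; apply: contraPneq qi => ->; rewrite mxE size_poly0.
have lev t : exists k, 0 < psi ((#|F| ^ n.+1) ^ t)%N ->
    level F m.+1 (psi ((#|F| ^ n.+1) ^ t)%N) k.
  have [/(level_exists F (ltn0Sn m))[k kP]|_] := ltP 0 (psi ((#|F| ^ n.+1) ^ t)%N).
    by exists k.
  by exists 0%N.
have [kappa kP] := choice lev.
have [C Cb] := cvg_condensed b2 psi0 psini cv.
have := @solutions_null R F _ _ mu (fun t => 0 < psi ((#|F| ^ n.+1) ^ t)%N) kappa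
  (#|F|%:R ^+ m.+1 * C) haar.
move=> /(_ _)/negligibleS; apply=> [A /contrapT/psi_approximableP WA j|v]; last first.
  apply: le_trans (ler_wpM2l (exprn_ge0 _ (ltW s0)) (Cb v)).
  rewrite mulr_sumr big_mkcond; apply: ler_sum => t _.
  case: ifPn => [/(kP t)[kt _]|_]; last first.
    by rewrite !mulr_ge0 ?exprn_ge0 ?(ltW s0) // psi0 // expn_gt0 (ltnW b2).
  rewrite mulrCA bE; apply: ler_wpM2l; first by rewrite exprn_ge0 // ltW.
  move: kt => /ltW; rewrite mulnS exprD invfM ler_pdivrMl ?exprn_gt0 //.
have [t [q [jt q0 hq [p pP]]]] := WA j.
have gt : 0 < psi ((#|F| ^ n.+1) ^ t)%N.
  by apply: le_lt_trans pP; rewrite exprn_ge0 // supnorm_ge0.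
exists t, q; split=> //; apply/(levelP _ _ _ (kP t gt)) => //; by exists p.
Qed.
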